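(* Almost every Turing degree is bounded by a high degree which is not almost everywhere dominating; that is, for almost all $X\in 2^\omega$ there is a set $B\geq_T X$ such that $B$ is high and $B$ is not almost everywhere dominating.
   Context: $\mu$ is the fair-coin (Lebesgue) probability measure on $2^\omega$; ''almost all'' means on a set of $\mu$-measure $1$. For $f,g\in\omega^\omega$, $f$ dominates $g$ if $\exists m\,\forall n>m\,(f(n)>g(n))$. A set $A$ is almost everywhere (a.e.) dominating if for almost all $X\in 2^\omega$ and all functions $g\leq_T X$, there is a function $f\leq_T A$ such that $f$ dominates $g$. A set $A$ is high if $A'\geq_T 0''$. *)

(* Defs.v *)
From HB Require Import structures.
From Stdlib Require Cantor.
From mathcomp Require Import all_boot all_order all_algebra.
From mathcomp Require Import zify.
From mathcomp Require Import all_classical all_reals all_analysis.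

Set Implicit Arguments.
Unset Strict Implicit.
Unset Printing Implicit Defensive.
Import Order.TTheory GRing.Theory Num.Theory.
Import numFieldNormedType.Exports.

Local Open Scope classical_set_scope.
Local Open Scope ring_scope.

Definition cylinder (s : seq bool) : set (nat -> bool) :=
  [set X | forall i, (i < size s)%N -> X i = nth false s i].

(* Generated by the cylinders: the Borel sigma-algebra of Cantor space. *)
Notation cantor := (g_sigma_algebraType (range cylinder)).

(* For [0 <= x < 1], [digits x n] is the binary digit of [x] of weight
   [2 ^- n.+1]. *)
Definition digits (R : realType) (x : measurableTypeR R) : cantor :=
  fun n => odd (Num.truncn (2 ^+ n.+1 * (x : R))).

Section digits_measurable.
Variable R : realType.

Let measurable_truncn_le n k :
  measurable [set x : measurableTypeR R |
    (Num.truncn (2 ^+ n * (x : R)) <= k)%N].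
Proof.
rewrite (_ : [set x | _] = `]-oo, (k.+1%:R / 2 ^+ n : R)[%classic).
  exact: measurable_itv.
apply/seteqP; split=> x /=; rewrite in_itv /= truncn_le_nat.
  by rewrite ltr_pdivlMr ?exprn_gt0// mulrC.
by rewrite ltr_pdivlMr ?exprn_gt0// mulrC.
Qed.

Let measurable_truncn_eq n k :
  measurable [set x : measurableTypeR R | Num.truncn (2 ^+ n * (x : R)) = k].
Proof.
case: k => [|k].
  rewrite (_ : [set x | _] = [set x : measurableTypeR R |
    (Num.truncn (2 ^+ n * (x : R)) <= 0)%N]); first exact: measurable_truncn_le.
  by apply/seteqP; split=> x /=; [move=> ->|rewrite leqn0 => /eqP].
rewrite (_ : [set x | _] = [set x : measurableTypeR R |
    (Num.truncn (2 ^+ n * (x : R)) <= k.+1)%N] `\` [set x : measurableTypeR R |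
    (Num.truncn (2 ^+ n * (x : R)) <= k)%N]).
  by apply: measurableD; exact: measurable_truncn_le.
apply/seteqP; split=> x /=.
  by move=> ->; split=> //; rewrite ltnn.
by case=> h1 /negP; rewrite -ltnNge => h2; apply/eqP; rewrite eqn_leq h1.
Qed.

Lemma measurable_digits : measurable_fun setT (@digits R).
Proof.
apply: (@measurability _ _ _ cantor _ _ (range cylinder)) => // _ [_ [s _ <-] <-].
rewrite setTI.
rewrite (_ : _ @^-1` _ = \bigcap_i [set x : measurableTypeR R |
    (i < size s)%N -> digits x i = nth false s i]); last first.
  by apply/seteqP; split=> [x h i _|x h i]; [exact: h|exact: h].
apply: bigcapT_measurable => i.
rewrite (_ : [set x | _] = \bigcup_(k in [set k |
    (i < size s)%N -> odd k = nth false s i])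
    [set x : measurableTypeR R | Num.truncn (2 ^+ i.+1 * (x : R)) = k]).
  by apply: bigcup_measurable => k _; exact: measurable_truncn_eq.
apply/seteqP; split=> [x h|x [k h /= hk]] /=.
  by exists (Num.truncn (2 ^+ i.+1 * (x : R))).
by rewrite /digits hk.
Qed.

End digits_measurable.

HB.instance Definition _ (R : realType) :=
  @isMeasurableFun.Build _ _ _ _ (@digits R) (@measurable_digits R).

Definition fair_coin (R : realType) : probability cantor R :=
  distribution (uniform_prob (@ltr01 R)) (@digits R).

Section fair_coin_cylinder.
Variable R : realType.

Let truncn_double (y : R) : 0 <= y -> (Num.truncn (2 * y))./2 = Num.truncn y.
Proof.
move=> y0; apply/esym/truncn_def.
have /andP[h1 h2] := truncn_itv (mulr_ge0 (ler0n R 2) y0).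
move: h1 h2; set k := Num.truncn (2 * y) => h1 h2.
have e := odd_double_half k.
have h3 : (k./2 * 2)%:R <= 2 * y :> R.
  by rewrite (le_trans _ h1)// ler_nat -{2}e muln2 leq_addl.
have h4 : 2 * y < (k./2.+1 * 2)%:R :> R.
  rewrite (lt_le_trans h2)// ler_nat -{1}e muln2 doubleS -addn1 addnC.
  by case: (odd k); rewrite ?add0n ?add1n.
rewrite !natrM mulrC ler_pM2l// in h3.
by rewrite natrM mulrC ltr_pM2r// in h4; rewrite h3 h4.
Qed.

Let value (s : seq bool) : nat := foldl (fun k (b : bool) => (b + k.*2)%N) 0%N s.

Let digits_prefix (s : seq bool) (x : R) : 0 <= x < 1 ->
  cylinder s (digits x) <-> Num.truncn (2 ^+ size s * x) = value s.
Proof.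
move=> /andP[x0 x1]; elim/last_ind: s => [|s b IH].
  rewrite expr0 mul1r; split => // _.
  by apply/truncn_def; rewrite x0 x1.
have e : Num.truncn (2 ^+ size (rcons s b) * x) =
    (digits x (size s) + (Num.truncn (2 ^+ size s * x)).*2)%N.
  rewrite size_rcons -(@truncn_double (2 ^+ size s * x)); last first.
    by rewrite mulr_ge0 ?exprn_ge0.
  by rewrite mulrA -exprS /digits odd_double_half.
rewrite e /value foldl_rcons -/(value s); split=> [h|h].
  congr (_ + _.*2)%N.
    by rewrite h ?size_rcons// nth_rcons ltnn eqxx.
  apply/IH => i ilt; rewrite h ?size_rcons ?nth_rcons ?ilt//.
  exact: ltnW.
have hb : digits x (size s) = b.
  by move/(congr1 odd): h; rewrite !oddD !odd_double !addbF !oddb.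
move=> i; rewrite size_rcons ltnS leq_eqVlt nth_rcons => /predU1P[->|ilt].
  by rewrite ltnn eqxx.
rewrite ilt; apply: (IH.2 _ i ilt).
by move: h; rewrite hb => /addnI/double_inj.
Qed.

Let value_lt s : (value s < 2 ^ size s)%N.
Proof.
elim/last_ind: s => [//|s b IH].
rewrite size_rcons /value foldl_rcons -/(value s) expnS mul2n.
by rewrite -(leq_double _.+1) doubleS in IH; case: b; apply: leq_trans IH.
Qed.

Lemma fair_coin_cylinder (s : seq bool) :
  fair_coin R (cylinder s) = (2 ^- size s)%:E.
Proof.
set n := size s.
have n0 : 0 < 2 ^+ n :> R by rewrite exprn_gt0.
pose I : set R := `[(value s)%:R / 2 ^+ n, (value s).+1%:R / 2 ^+ n[%classic.
have I01 : I `<=` `[0, 1]%classic.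
  move=> x; rewrite /I /= !in_itv /= => /andP[h1 h2].
  rewrite (le_trans _ h1) ?divr_ge0// ltW// (lt_le_trans h2)//.
  by rewrite ler_pdivrMr// mul1r -natrX ler_nat value_lt.
have mpre : measurable (@digits R @^-1` cylinder s).
  rewrite -[X in measurable X]setTI; apply: measurable_digits => //.
  by apply: sub_sigma_algebra; exists s.
have preE : (@digits R @^-1` cylinder s) `&` `[0, 1[%classic = I.
  apply/seteqP; split=> [x [hx]|x Ix].
    rewrite /= in_itv /= => x01; move/(digits_prefix _ x01): hx => hx.
    have /andP[x0 _] := x01.
    have := truncn_itv (mulr_ge0 (exprn_ge0 n (ler0n R 2)) x0).
    rewrite hx /I /= in_itv /= => /andP[h1 h2].
    by rewrite ler_pdivrMr// ltr_pdivlMr// mulrC h1.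
  have x01 : 0 <= x < 1.
    have := I01 _ Ix; rewrite /= in_itv /= => /andP[-> _].
    move: Ix; rewrite /I /= in_itv /= => /andP[_ h2].
    by rewrite (lt_le_trans h2)// ler_pdivrMr// mul1r -natrX ler_nat value_lt.
  split; last by rewrite /= in_itv.
  apply/(digits_prefix _ x01)/truncn_def.
  move: Ix; rewrite /I /= in_itv /= => /andP[h1 h2].
  by rewrite mulrC -ler_pdivrMr// h1 -ltr_pdivlMr.
have pre01 : (@digits R @^-1` cylinder s) `&` `[0, 1]%classic =
    I `|` (@digits R @^-1` cylinder s) `&` [set 1].
  rewrite -preE -setIUr; congr (_ `&` _); apply/seteqP; split=> x /=.
    rewrite !in_itv /= => /andP[x0]; rewrite le_eqVlt => /predU1P[->|x1].
      by right.
    by left; rewrite x0.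
  by rewrite !in_itv /= => -[/andP[-> /ltW]//|->]; rewrite ler01 lexx.
rewrite /fair_coin /distribution /pushforward /= /uniform_prob.
rewrite integral_uniform_pdf.
rewrite (eq_integral (fun=> 1%E)); last first.
  move=> x /set_mem [_]; rewrite /= in_itv /= /uniform_pdf => ->.
  by rewrite subr0 invr1.
rewrite integral_cst /=; last by apply: measurableI => //; exact: measurable_itv.
rewrite mul1e pre01 measureU0; last 3 first.
- exact: measurable_itv.
- exact: measurableI.
- apply: (@subset_measure0 _ _ _ lebesgue_measure _ [set 1]) => //.
  + exact: measurableI.
  + exact: lebesgue_measure_set1.
rewrite /= /I lebesgue_measure_itv /= lte_fin ltr_pM2r ?invr_gt0// ltr_nat ltnSn.
by rewrite -EFinB -mulrBl -natrB// subSnn mul1r.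
Qed.

End fair_coin_cylinder.

Local Close Scope ring_scope.
Local Open Scope nat_scope.

Local Arguments Cantor.to_nat : simpl never.
Local Arguments Cantor.of_nat : simpl never.
Local Notation "<< m , n >>" := (Cantor.to_nat (m, n)).

(* Programs for the partial functions on [nat] that are recursive in an oracle;
   several arguments are passed as one, through Cantor's pairing bijection. *)
Inductive program : Type :=
  | PZero | PSucc | PFst | PSnd | POracle
  | PPair of program & program
  | PComp of program & program
  | PPrec of program & program
  | PMin of program.

(* [run A p x y]: with oracle [A], program [p] on input [x] halts with
   output [y]. *)
Fixpoint run (A : nat -> bool) (p : program) : nat -> nat -> Prop :=
  match p with
  | PZero => fun _ y => y = 0
  | PSucc => fun x y => y = x.+1
  | PFst => fun x y => y = (Cantor.of_nat x).1
  | PSnd => fun x y => y = (Cantor.of_nat x).2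
  | POracle => fun x y => y = A x
  | PPair p q => fun x y =>
      exists u v, [/\ run A p x u, run A q x v & y = <<u, v>>]
  | PComp p q => fun x y => exists2 u, run A q x u & run A p u y
  | PPrec p q => fun x =>
      let a := (Cantor.of_nat x).1 in
      (fix rec (n y : nat) : Prop :=
        if n is k.+1
        then exists2 u, rec k u & run A q <<a, <<k, u>>>> y
        else run A p a y) (Cantor.of_nat x).2
  | PMin p => fun x y =>
      run A p <<x, y>> 0 /\
      forall k, k < y -> exists u, run A p <<x, k>> u.+1
  end.

Definition computable_from (A : nat -> bool) (g : nat -> nat) : Prop :=
  exists p, forall n, run A p n (g n).

Definition turing_le (X B : nat -> bool) : Prop :=
  computable_from B (fun n => nat_of_bool (X n)).

(* Goedel numbering; a bijection by [godel_inj] and [godel_surj]. *)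
Fixpoint godel (p : program) : nat :=
  match p with
  | PZero => 0
  | PSucc => 1
  | PFst => 2
  | PSnd => 3
  | POracle => 4
  | PPair p q => 5 + 4 * <<godel p, godel q>>
  | PComp p q => 6 + 4 * <<godel p, godel q>>
  | PPrec p q => 7 + 4 * <<godel p, godel q>>
  | PMin p => 8 + 4 * godel p
  end.

Lemma godel_inj : injective godel.
Proof.
have inj2 (a b c d : nat) : <<a, b>> = <<c, d>> -> a = c /\ b = d.
  by move/Cantor.to_nat_inj => [-> ->].
elim=> [|||||p IHp q IHq|p IHp q IHq|p IHp q IHq|p IHp]
       [|||||p' q'|p' q'|p' q'|p'] //= e; try by exfalso; lia.
- have /inj2[/IHp-> /IHq->//] : <<godel p, godel q>> = <<godel p', godel q'>>.
  by lia.
- have /inj2[/IHp-> /IHq->//] : <<godel p, godel q>> = <<godel p', godel q'>>.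
  by lia.
- have /inj2[/IHp-> /IHq->//] : <<godel p, godel q>> = <<godel p', godel q'>>.
  by lia.
- by rewrite (IHp p')//; lia.
Qed.

Lemma godel_surj e : exists p, godel p = e.
Proof.
elim/ltn_ind: e => e IH.
have [e4|e5] := leqP e 4.
  case: e {IH} e4 => [|[|[|[|[|//]]]]] _;
  by [exists PZero|exists PSucc|exists PFst|exists PSnd|exists POracle].
have [/eqP r3|r3] := boolP ((e - 5) %% 4 == 3).
  have [|p hp] := IH ((e - 5) %/ 4); first by lia.
  by exists (PMin p); rewrite /= hp; lia.
pose ab := Cantor.of_nat ((e - 5) %/ 4).
have habE : <<ab.1, ab.2>> = (e - 5) %/ 4.
  by rewrite -[RHS]Cantor.cancel_to_of -/ab; case: (ab).
have hab := Cantor.to_nat_non_decreasing ab.1 ab.2.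
rewrite habE in hab.
have [|p hp] := IH ab.1; first by lia.
have [|q hq] := IH ab.2; first by lia.
have [/eqP r0|r0] := boolP ((e - 5) %% 4 == 0).
  by exists (PPair p q); rewrite /= hp hq habE; lia.
have [/eqP r1|r1] := boolP ((e - 5) %% 4 == 1).
  by exists (PComp p q); rewrite /= hp hq habE; lia.
by exists (PPrec p q); rewrite /= hp hq habE; lia.
Qed.

Definition jump (A : nat -> bool) : nat -> bool :=
  fun e => `[< exists p, godel p = e /\ exists y, run A p e y >].

Definition empty : nat -> bool := fun=> false.

Definition high (A : nat -> bool) : Prop := turing_le (jump (jump empty)) (jump A).

Definition dominates (f g : nat -> nat) : Prop :=
  exists m, forall n, m < n -> g n < f n.

Definition ae_dominating (R : realType) (A : nat -> bool) : Prop :=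
  {ae fair_coin R, forall X : cantor, forall g, computable_from X g ->
    exists2 f, computable_from A f & dominates f g}.

(* Main.v *)
From HB Require Import structures.
From Stdlib Require Cantor.
Require Import Defs.
From mathcomp Require Import all_boot all_order all_algebra.
From mathcomp Require Import zify ring.
From mathcomp Require Import all_classical all_reals all_analysis.
From mathcomp Require Import measurable_realfun.

(* The set [B] has [X] as its column [0] and a set [C], the same for almost all
   [X], in its other columns. The column [n.+1] of [C] converges to the value
   of the double jump of [empty] at [n], so that [B] is high. The rest of [C] is
   generic for finite conditions with finitely many columns locked to their
   limits, which keeps the search for extensions computable.

   Against a universal family of computable searches, [escape Y] is a
   [Y]-computable function, total for a non-negligible set of [Y], that is not
   dominated by the time bound of any successful search: as in Martin's proof
   that almost every degree is hyperimmune, only a small cylinder of oracles [Y]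
   waits for each step of a search, and a new cylinder is chosen cyclically
   after each step.

   Given a program [p], extend the condition until the measure of the oracles
   [X] for which [p] converges on a long initial segment can neither grow nor
   be lowered by more than [1 / b]. Then conditions making [p] converge for
   almost that measure can be found by search, and the values of [p] for all but
   [1 / b] of the relevant [X] are bounded by the search time at each argument.
   So for most pairs [(X, Y)], [p] relative to [B] does not dominate
   [escape Y]. *)

Set Implicit Arguments.
Unset Strict Implicit.
Unset Printing Implicit Defensive.

Import Order.TTheory GRing.Theory Num.Theory.

Local Open Scope nat_scope.

(** * Pairing, and uniqueness of computed values *)

Definition npair (x y : nat) : nat := Cantor.to_nat (x, y).
Definition nfst (z : nat) : nat := (Cantor.of_nat z).1.
Definition nsnd (z : nat) : nat := (Cantor.of_nat z).2.
Local Notation "<< x , y >>" := (npair x y).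

Lemma nfst_pair x y : nfst <<x, y>> = x.
Proof. by rewrite /nfst /npair Cantor.cancel_of_to. Qed.

Lemma nsnd_pair x y : nsnd <<x, y>> = y.
Proof. by rewrite /nsnd /npair Cantor.cancel_of_to. Qed.

Lemma npair_eta z : <<nfst z, nsnd z>> = z.
Proof.
by rewrite /nfst /nsnd /npair -[RHS]Cantor.cancel_to_of; case: Cantor.of_nat.
Qed.

Lemma leq_npair x y : x <= <<x, y>> /\ y <= <<x, y>>.
Proof.
have h := Cantor.to_nat_non_decreasing x y.
by rewrite /npair; lia.
Qed.

Lemma run_functional A p x y y' : run A p x y -> run A p x y' -> y = y'.
Proof.
elim: p x y y' => /= [|||||p IHp q IHq|p IHp q IHq|p IHp q IHq|p IHp] x y y'.
1-5: by move=> -> ->.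
- by move=> [u [v [pu qv ->]]] [u' [v' [/(IHp _ _ _ pu) <- /(IHq _ _ _ qv) <- ->]]].
- by move=> [u qu pu] [u' /(IHq _ _ _ qu) <-]; exact: IHp.
- elim: (Cantor.of_nat x).2 y y' => [|k IHk] y y'; first exact: IHp.
  by move=> [u ru qu] [u' /(IHk _ _ ru) <-]; exact: IHq.
- move=> [py lty] [py' lty'].
  have [lt|lt|//] := ltngtP y y'.
    by have [u /(IHp _ _ _ py)] := lty' _ lt.
  by have [u /(IHp _ _ _ py')] := lty _ lt.
Qed.

(** * Closure properties of relative computability *)

Section Computable.
Variable A : nat -> bool.
Local Notation computable f := (computable_from A f).

Lemma computable_ext f g : f =1 g -> computable f -> computable g.
Proof. by move=> fg [p pf]; exists p => n; rewrite -fg. Qed.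

Lemma computable_comp f g : computable f -> computable g ->
  computable (fun x => f (g x)).
Proof. by move=> [p pf] [q qg]; exists (PComp p q) => n; exists (g n). Qed.

Lemma computable_pair f g : computable f -> computable g ->
  computable (fun x => <<f x, g x>>).
Proof.
by move=> [p pf] [q qg]; exists (PPair p q) => n; exists (f n), (g n).
Qed.

Lemma computable_fst f : computable f -> computable (fun x => nfst (f x)).
Proof. by apply: computable_comp; exists PFst. Qed.

Lemma computable_snd f : computable f -> computable (fun x => nsnd (f x)).
Proof. by apply: computable_comp; exists PSnd. Qed.

Lemma computable_succ f : computable f -> computable (fun x => (f x).+1).
Proof. by apply: (@computable_comp succn); exists PSucc. Qed.

Lemma computable_oracle f : computable f -> computable (fun x => A (f x)).
Proof. by apply: (@computable_comp (fun x => A x)); exists POracle. Qed.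

Lemma computable_id : computable (fun x => x).
Proof.
apply: (@computable_ext (fun x => <<nfst x, nsnd x>>)) => [x|].
  exact: npair_eta.
by apply: computable_pair; [exists PFst|exists PSnd].
Qed.

Lemma computable_const c : computable (fun=> c).
Proof.
elim: c => [|c IHc]; first by exists PZero.
exact: computable_succ.
Qed.

(** [PPrec] keeps its parameter fixed, so passing the whole [x] as parameter lets [h], [g] and [f]
    all depend on it. Arithmetic, conditionals and bounded quantifiers reduce to this scheme. *)
Lemma computable_iteri h g f :
  computable h -> computable f ->
  computable (fun z => g (nfst z) (nfst (nsnd z)) (nsnd (nsnd z))) ->
  computable (fun x => iteri (h x) (g x) (f x)).
Proof.
move=> ch [p pf] [q qg].
have: computable (fun z => iteri (nsnd z) (g (nfst z)) (f (nfst z))).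
  exists (PPrec p q) => z /=; rewrite -/(nsnd z) -/(nfst z).
  elim: (nsnd z) => [|k IHk]; first exact: pf.
  exists (iteri k (g (nfst z)) (f (nfst z))) => //=.
  by have := qg (<<nfst z, <<k, iteri k (g (nfst z)) (f (nfst z))>>>>);
    rewrite !(nfst_pair, nsnd_pair).
move=> /computable_comp/(_ (computable_pair computable_id ch)).
by apply: computable_ext => x; rewrite nfst_pair nsnd_pair.
Qed.

Lemma computable_iter h g f :
  computable h -> computable f -> computable (fun z => g (nfst z) (nsnd z)) ->
  computable (fun x => iter (h x) (g x) (f x)).
Proof.
move=> ch cf cg.
apply: (@computable_ext (fun x => iteri (h x) (fun=> g x) (f x))) => [x|].
  by elim: (h x) => //= k ->.
apply: computable_iteri => //.
have := computable_comp cg (computable_pair (computable_fst computable_id)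
  (computable_snd (computable_snd computable_id))).
by apply: computable_ext => z; rewrite nfst_pair nsnd_pair.
Qed.

Lemma computable_if b f g :
  computable (fun x => nat_of_bool (b x)) -> computable f -> computable g ->
  computable (fun x => if b x then f x else g x).
Proof.
move=> cb cf cg.
apply: (@computable_ext (fun x => iteri (b x) (fun _ _ => f x) (g x))) => [x|].
  by case: (b x).
apply: computable_iteri => //; apply: computable_comp cf _.
exact: computable_fst computable_id.
Qed.

Lemma computable_ifb (b f g : nat -> bool) :
  computable (fun x => b x) -> computable (fun x => f x) ->
  computable (fun x => g x) -> computable (fun x => if b x then f x else g x).
Proof.
move=> cb cf cg.
apply: (@computable_ext (fun x => if b x then nat_of_bool (f x) else g x)).
  by move=> x; case: (b x).
exact: computable_if.
Qed.

Lemma computable_pred f : computable f -> computable (fun x => (f x).-1).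
Proof.
move=> cf.
apply: (@computable_ext (fun x => iteri (f x) (fun k _ => k) 0)) => [x|].
  by case: (f x).
apply: computable_iteri => //; first exact: computable_const.
exact: computable_fst (computable_snd computable_id).
Qed.

Lemma computable_sub f g : computable f -> computable g ->
  computable (fun x => f x - g x).
Proof.
move=> cf cg.
apply: (@computable_ext (fun x => iter (g x) (fun u => u.-1) (f x))) => [x|].
  elim: (g x) => [|k IHk] /=; first by rewrite subn0.
  by rewrite IHk subnS.
apply: computable_iter => //; apply: computable_pred.
exact: computable_snd computable_id.
Qed.

Lemma computable_add f g : computable f -> computable g ->
  computable (fun x => f x + g x).
Proof.
move=> cf cg.
apply: (@computable_ext (fun x => iter (g x) (fun u => u.+1) (f x))) => [x|].
  by elim: (g x) => [|k IHk] /=; rewrite ?addn0 ?addnS ?IHk.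
apply: computable_iter => //; apply: computable_succ.
exact: computable_snd computable_id.
Qed.

Lemma computable_mul f g : computable f -> computable g ->
  computable (fun x => f x * g x).
Proof.
move=> cf cg.
apply: (@computable_ext (fun x => iter (g x) (fun u => u + f x) 0)) => [x|].
  by elim: (g x) => [|k IHk] /=; rewrite ?muln0 ?mulnS ?IHk // addnC.
apply: computable_iter => //; first exact: computable_const.
apply: computable_add; first exact: computable_snd computable_id.
by apply: computable_comp cf _; exact: computable_fst computable_id.
Qed.

Lemma computable_expn f g : computable f -> computable g ->
  computable (fun x => f x ^ g x).
Proof.
move=> cf cg.
apply: (@computable_ext (fun x => iter (g x) (fun u => f x * u) 1)) => [x|].
  by elim: (g x) => [|k IHk] /=; rewrite ?expn0 ?expnS ?IHk.
apply: computable_iter => //; first exact: computable_const.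
apply: computable_mul; last exact: computable_snd computable_id.
by apply: computable_comp cf _; exact: computable_fst computable_id.
Qed.

Lemma computable_not (b : nat -> bool) : computable (fun x => b x) ->
  computable (fun x => ~~ b x).
Proof.
move=> cb; apply: (@computable_ext (fun x => 1 - b x)) => [x|].
  by case: (b x).
by apply: computable_sub => //; exact: computable_const.
Qed.

Lemma computable_leq f g : computable f -> computable g ->
  computable (fun x => f x <= g x).
Proof.
move=> cf cg; apply: (@computable_ext (fun x => 1 - (f x - g x))) => [x|].
  by lia.
by apply: computable_sub; [exact: computable_const|exact: computable_sub].
Qed.

Lemma computable_and (b c : nat -> bool) : computable (fun x => b x) ->
  computable (fun x => c x) -> computable (fun x => b x && c x).
Proof.
move=> cb cc; apply: (@computable_ext (fun x => b x * c x)) => [x|].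
  by rewrite mulnb.
exact: computable_mul.
Qed.

Lemma computable_or (b c : nat -> bool) : computable (fun x => b x) ->
  computable (fun x => c x) -> computable (fun x => b x || c x).
Proof.
move=> cb cc.
apply: (@computable_ext (fun x => ~~ (~~ b x && ~~ c x))) => [x|].
  by rewrite negb_and !negbK.
by apply: computable_not; apply: computable_and; exact: computable_not.
Qed.

Lemma computable_implb (b c : nat -> bool) : computable (fun x => b x) ->
  computable (fun x => c x) -> computable (fun x => b x ==> c x).
Proof.
move=> cb cc; apply: (@computable_ext (fun x => ~~ b x || c x)) => [x|].
  by rewrite implybE.
by apply: computable_or => //; exact: computable_not.
Qed.

Lemma computable_eqn f g : computable f -> computable g ->
  computable (fun x => f x == g x).
Proof.
move=> cf cg.
apply: (@computable_ext (fun x => (f x <= g x) && (g x <= f x))) => [x|].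
  by rewrite -eqn_leq.
by apply: computable_and; exact: computable_leq.
Qed.

Lemma computable_eqb (b c : nat -> bool) : computable (fun x => b x) ->
  computable (fun x => c x) -> computable (fun x => b x == c x).
Proof.
move=> cb cc.
apply: (@computable_ext (fun x => nat_of_bool (b x) == nat_of_bool (c x))) => [x|].
  by case: (b x); case: (c x).
exact: computable_eqn.
Qed.

Lemma computable_count h (P : nat -> nat -> bool) : computable h ->
  computable (fun z => P (nfst z) (nsnd z)) ->
  computable (fun x => count (P x) (iota 0 (h x))).
Proof.
move=> ch cP.
apply: (@computable_ext (fun x => iteri (h x) (fun k u => u + P x k) 0)) => [x|].
  elim: (h x) => // k IHk.
  by rewrite -[k.+1]addn1 iotaD count_cat addn1 /= IHk add0n addn0.
apply: computable_iteri => //; first exact: computable_const.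
apply: computable_add.
  exact: computable_snd (computable_snd computable_id).
have := computable_comp cP (computable_pair (computable_fst computable_id)
  (computable_fst (computable_snd computable_id))).
by apply: computable_ext => z; rewrite nfst_pair nsnd_pair.
Qed.

Lemma computable_has h (P : nat -> nat -> bool) : computable h ->
  computable (fun z => P (nfst z) (nsnd z)) ->
  computable (fun x => has (P x) (iota 0 (h x))).
Proof.
move=> ch cP.
apply: (@computable_ext (fun x => 1 <= count (P x) (iota 0 (h x)))) => [x|].
  by rewrite has_count.
apply: computable_leq; first exact: computable_const.
exact: computable_count.
Qed.

Lemma computable_all h (P : nat -> nat -> bool) : computable h ->
  computable (fun z => P (nfst z) (nsnd z)) ->
  computable (fun x => all (P x) (iota 0 (h x))).
Proof.
move=> ch cP.
apply: (@computable_ext (fun x => count (P x) (iota 0 (h x)) == h x)) => [x|].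
  by rewrite all_count size_iota.
by apply: computable_eqn => //; exact: computable_count.
Qed.

Lemma computable_min (P : nat -> nat -> bool) f :
  computable (fun z => P (nfst z) (nsnd z)) ->
  (forall x, P x (f x) /\ forall k, k < f x -> ~~ P x k) -> computable f.
Proof.
(* [PMin] looks for the value 0, hence the program for the negation of [P]. *)
move=> /computable_not[p cp] hf; exists (PMin p) => x.
have [hx lt] := hf x; split.
  by have := cp <<x, f x>>; rewrite nfst_pair nsnd_pair hx.
move=> k /lt/negbTE hk; exists 0.
by have := cp <<x, k>>; rewrite nfst_pair nsnd_pair hk.
Qed.

End Computable.

(** * Natural numbers as finite sets and bit strings *)

Definition bit (S z : nat) : bool := odd (iter z half S).

Fixpoint code_bits (n : nat) (f : nat -> bool) : nat :=
  if n is m.+1 then f 0 + (code_bits m (fun i => f i.+1)).*2 else 0.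

Lemma bitS S z : bit S z.+1 = bit S./2 z.
Proof. by rewrite /bit iterSr. Qed.

Lemma bit_code n f z : bit (code_bits n f) z = (z < n) && f z.
Proof.
elim: n f z => [|n IHn] f [|z] //=.
- by rewrite /bit; elim: z => //= z IHz; rewrite -iterS iterSr.
- by rewrite /bit /= oddD odd_double addbF oddb.
by rewrite bitS halfD odd_double andbF doubleK add0n; case: (f 0); rewrite IHn.
Qed.

Lemma code_bits_lt n f : code_bits n f < 2 ^ n.
Proof.
elim: n f => [//|n IHn] f /=; have := IHn (fun i => f i.+1).
by rewrite expnS; case: (f 0) => /=; lia.
Qed.

(** This allows quantifiers over the members of a coded set to be bounded by the code itself. *)
Lemma bit_lt S z : bit S z -> z < S.
Proof.
elim: z S => [|z IHz] S; first by case: S.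
by rewrite bitS => /IHz; lia.
Qed.

Lemma code_bitsK n S : S < 2 ^ n -> code_bits n (bit S) = S.
Proof.
elim: n S => [|n IHn] S /=; first by rewrite expn0; lia.
rewrite expnS => lt.
have -> : code_bits n (fun i => bit S i.+1) = code_bits n (bit S./2).
  by congr code_bits; apply/funext => i; rewrite bitS.
rewrite IHn; last by lia.
by rewrite {1}/bit /= odd_double_half.
Qed.

Lemma eq_code_bits n f g : (forall i, i < n -> f i = g i) ->
  code_bits n f = code_bits n g.
Proof.
elim: n f g => //= n IHn f g fg; rewrite fg//; congr (_ + _.*2).
by apply: IHn => i lt; exact: fg.
Qed.

Lemma computable_bit A f g : computable_from A f -> computable_from A g ->
  computable_from A (fun x => bit (f x) (g x)).
Proof.
move=> cf cg.
have chalf : computable_from A half.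
  (* Recursion [half n.+1 = n - half n]. *)
  apply: (@computable_ext _ (fun n => iteri n (fun k u => k - u) 0)) => [n|].
    by elim: n => //= n ->; rewrite uphalf_half; lia.
  apply: computable_iteri; first exact: computable_id.
    exact: computable_const.
  apply: computable_sub.
    exact: computable_fst (computable_snd (computable_id _)).
  exact: computable_snd (computable_snd (computable_id _)).
have codd : computable_from A (fun n => odd n).
  apply: (@computable_ext _ (fun n => iter n (fun u => 1 - u) 0)) => [n|].
    by elim: n => //= n ->; case: odd.
  apply: computable_iter; first exact: computable_id.
    exact: computable_const.
  apply: computable_sub; first exact: computable_const.
  exact: computable_snd (computable_id _).
apply: (computable_comp codd); apply: computable_iter => //.
by apply: (computable_comp chalf); exact: computable_snd (computable_id _).
Qed.

(** Decomposes a function by its outermost operation, falling back on hypotheses and the oracle;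
    goals without a rule are left to the caller. *)
Ltac computable :=
  cbn beta;
  lazymatch goal with
  | |- computable_from _ (fun x => x) => exact: computable_id
  | |- computable_from _ (fun _ => ?c) => exact: computable_const
  | |- computable_from _ (fun x => <<@?f x, @?g x>>) =>
      refine (@computable_pair _ f g _ _); computable
  | |- computable_from _ (fun x => nfst (@?f x)) =>
      refine (@computable_fst _ f _); computable
  | |- computable_from _ (fun x => nsnd (@?f x)) =>
      refine (@computable_snd _ f _); computable
  | |- computable_from _ (fun x => (@?f x).+1) =>
      refine (@computable_succ _ f _); computable
  | |- computable_from _ (fun x => (@?f x).-1) =>
      refine (@computable_pred _ f _); computable
  | |- computable_from _ (fun x => (@?f x) + (@?g x)) =>
      refine (@computable_add _ f g _ _); computable
  | |- computable_from _ (fun x => (@?f x) * (@?g x)) =>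
      refine (@computable_mul _ f g _ _); computable
  | |- computable_from _ (fun x => (@?f x) ^ (@?g x)) =>
      refine (@computable_expn _ f g _ _); computable
  | |- computable_from _ (fun x => if _ then _ else _) =>
      apply: computable_if; computable
  | |- computable_from _ (fun x => nat_of_bool (if _ then _ else _)) =>
      apply: computable_ifb; computable
  | |- computable_from _ (fun x => count (@?P x) (iota 0 (@?h x))) =>
      refine (@computable_count _ h P _ _); computable
  | |- computable_from _ (fun x => nat_of_bool (bit (@?f x) (@?g x))) =>
      refine (@computable_bit _ f g _ _); computable
  | |- computable_from _ (fun x => nat_of_bool (has (@?P x) (iota 0 (@?h x)))) =>
      refine (@computable_has _ h P _ _); computable
  | |- computable_from _ (fun x => nat_of_bool (all (@?P x) (iota 0 (@?h x)))) =>
      refine (@computable_all _ h P _ _); computable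
  | |- computable_from _ (fun x => nat_of_bool (~~ (@?b x))) =>
      refine (@computable_not _ b _); computable
  | |- computable_from _ (fun x => nat_of_bool ((@?b x) && (@?c x))) =>
      refine (@computable_and _ b c _ _); computable
  | |- computable_from _ (fun x => nat_of_bool ((@?b x) || (@?c x))) =>
      refine (@computable_or _ b c _ _); computable
  | |- computable_from _ (fun x => nat_of_bool ((@?b x) ==> (@?c x))) =>
      refine (@computable_implb _ b c _ _); computable
  | |- computable_from _ (fun x => nat_of_bool ((@?f x) <= (@?g x))) =>
      refine (@computable_leq _ f g _ _); computable
  | |- computable_from _ (fun x => nat_of_bool (@eq_op _ (@?f x) (@?g x))) =>
      first [refine (@computable_eqn _ f g _ _)|
             refine (@computable_eqb _ f g _ _)]; computable
  | |- computable_from _ nfst => exact: computable_fst (computable_id _)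
  | |- computable_from _ nsnd => exact: computable_snd (computable_id _)
  | _ => first [
      match goal with
      | H : computable_from _ ?f |- computable_from _ (fun x => ?f (@?g x)) =>
          refine (computable_comp H _); computable
      | |- computable_from ?A (fun x => nat_of_bool (?A (@?g x))) =>
          refine (computable_oracle _); computable
      end
    | idtac ]
  end.

Local Arguments Cantor.to_nat : simpl never.
Local Arguments Cantor.of_nat : simpl never.

(** * Finite certificates for convergence *)

Definition query (r c z : nat) : bool :=
  if nfst z == 0 then bit r (nsnd z) else bit c z.

(* [S] codes a finite set of triples [<<godel p, <<x, y>>>>], read as the
   claims that program [p] maps [x] to [y]; [step] checks that such a claim
   follows in one step from the claims in [S], using the oracle [query r c]
   only below [l]. *)
Definition step (r c l S e x y : nat) : bool :=
  [|| (e == 0) && (y == 0), (e == 1) && (y == x.+1),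
      (e == 2) && (y == nfst x), (e == 3) && (y == nsnd x),
      [&& e == 4, x < l & y == query r c x],
      has (fun p => has (fun q =>
        [|| (e == 5 + 4 * <<p, q>>) &&
              has (fun u => has (fun v =>
                [&& bit S <<p, <<x, u>>>>, bit S <<q, <<x, v>>>>
                  & y == <<u, v>>]) (iota 0 S)) (iota 0 S),
            (e == 6 + 4 * <<p, q>>) &&
              has (fun u => bit S <<q, <<x, u>>>> && bit S <<p, <<u, y>>>>)
                (iota 0 S)
          | (e == 7 + 4 * <<p, q>>) &&
              (if nsnd x == 0 then bit S <<p, <<nfst x, y>>>>
               else has (fun u =>
                 bit S <<e, <<<<nfst x, (nsnd x).-1>>, u>>>> &&
                 bit S <<q, <<<<nfst x, <<(nsnd x).-1, u>>>>, y>>>>)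
                 (iota 0 S))])
        (iota 0 e)) (iota 0 e)
    | has (fun p => (e == 8 + 4 * p) &&
        (bit S <<p, <<<<x, y>>, 0>>>> &&
         all (fun k => has (fun u => bit S <<p, <<<<x, k>>, u.+1>>>>) (iota 0 S))
           (iota 0 y)))
        (iota 0 e)].

Definition valid (r c l S : nat) : bool :=
  all (fun z => bit S z ==>
    step r c l S (nfst z) (nfst (nsnd z)) (nsnd (nsnd z))) (iota 0 S).

(* Certificates below [w] show that program [p] converges on [0, ..., N] with
   oracle [query r c], queried only below [l]. *)
Definition converges (r c l w p N : nat) : bool :=
  has (fun S => valid r c l S &&
    all (fun n => has (fun y => bit S <<p, <<n, y>>>>) (iota 0 S)) (iota 0 N.+1))
    (iota 0 w).

Lemma computable_converges A r c l w p N :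
  computable_from A r -> computable_from A c -> computable_from A l ->
  computable_from A w -> computable_from A p -> computable_from A N ->
  computable_from A (fun x => converges (r x) (c x) (l x) (w x) (p x) (N x)).
Proof.
move=> *; rewrite /converges /valid /step /query.
computable.
Qed.

(** The rules of [step], but over programs instead of codes and over an arbitrary relation [P] of
    accepted claims, so that number-coded and list-coded sets of claims share one notion. *)
Definition derivable (O : nat -> bool) (l : nat)
    (P : program -> nat -> nat -> Prop) (p : program) (x y : nat) : Prop :=
  match p with
  | PZero => y = 0
  | PSucc => y = x.+1
  | PFst => y = nfst x
  | PSnd => y = nsnd x
  | POracle => x < l /\ y = O x
  | PPair p q => exists u v, [/\ P p x u, P q x v & y = <<u, v>>]
  | PComp p q => exists2 u, P q x u & P p u y
  | PPrec p0 q =>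
      if nsnd x is k.+1
      then exists2 u, P p <<nfst x, k>> u & P q <<nfst x, <<k, u>>>> y
      else P p0 (nfst x) y
  | PMin p =>
      P p <<x, y>> 0 /\ forall k, k < y -> exists u, P p <<x, k>> u.+1
  end.

Lemma bit_triple S e x y : bit S <<e, <<x, y>>>> -> [/\ e < S, x < S & y < S].
Proof.
move=> /bit_lt; have := leq_npair e <<x, y>>; have := leq_npair x y.
by split; lia.
Qed.

Lemma has_iotaP (P : pred nat) n :
  reflect (exists2 k, k < n & P k) (has P (iota 0 n)).
Proof. by apply: (iffP hasP) => -[k kn Pk]; exists k; rewrite ?mem_iota in kn *. Qed.

Lemma all_iotaP (P : pred nat) n :
  reflect (forall k, k < n -> P k) (all P (iota 0 n)).
Proof.
by apply: (iffP allP) => h k kn; apply: h; rewrite ?mem_iota in kn *.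
Qed.

Lemma npair_inj x y x' y' : <<x, y>> = <<x', y'>> -> x = x' /\ y = y'.
Proof. by move=> /Cantor.to_nat_inj [-> ->]. Qed.

(** The bounds on the quantifiers of [step] lose nothing: subprograms have smaller codes, and
    [bit_triple] bounds the entries of a claim in [S]. *)
Lemma stepP r c l S p x y :
  step r c l S (godel p) x y <->
  derivable (query r c) l (fun p x y => bit S <<godel p, <<x, y>>>>) p x y.
Proof.
split.
  case/orP => [/andP[/eqP e /eqP yE]|].
    by rewrite (@godel_inj p PZero).
  case/orP => [/andP[/eqP e /eqP yE]|].
    by rewrite (@godel_inj p PSucc).
  case/orP => [/andP[/eqP e /eqP yE]|].
    by rewrite (@godel_inj p PFst).
  case/orP => [/andP[/eqP e /eqP yE]|].
    by rewrite (@godel_inj p PSnd).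
  case/orP => [/and3P[/eqP e xl /eqP yE]|].
    by rewrite (@godel_inj p POracle).
  case/orP => [|/has_iotaP[a _ /and3P[/eqP e b h]]]; last first.
    have [q qE] := godel_surj a; subst a.
    rewrite (@godel_inj p (PMin q))//; split => // k ky.
    have /has_iotaP[u _ hu] := (all_iotaP _ _ h) _ ky.
    by exists u.
  case/has_iotaP => a _ /has_iotaP[b _].
  have [q qE] := godel_surj a; have [q' qE'] := godel_surj b; subst a b.
  case/or3P => /andP[/eqP e].
  - case/has_iotaP => u _ /has_iotaP[v _] /and3P[hu hv /eqP yE].
    by rewrite (@godel_inj p (PPair q q'))//=; exists u, v.
  - case/has_iotaP => u _ /andP[hu hv].
    by rewrite (@godel_inj p (PComp q q'))//=; exists u.
  - rewrite e (@godel_inj p (PPrec q q'))//.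
    rewrite /derivable; case: (nsnd x) => [//|k].
    case/has_iotaP => u _ /andP[hu hv].
    by exists u.
rewrite /step; case: p => [|||||p q|p q|p q|p].
- by move=> ->; rewrite !eqxx.
- by move=> ->; rewrite !eqxx orbT.
- by move=> ->; rewrite !eqxx !orbT.
- by move=> ->; rewrite !eqxx !orbT.
- by move=> [xl ->]; rewrite xl !eqxx !orbT.
- move=> [u [v [hu hv yE]]]; do 5 (apply/orP; right).
  have := leq_npair (godel p) (godel q); rewrite /npair => hpq.
  apply/orP; left; apply/has_iotaP; exists (godel p); first by rewrite /=; lia.
  apply/has_iotaP; exists (godel q); first by rewrite /=; lia.
  rewrite eqxx andTb; apply/orP; left.
  apply/has_iotaP; exists u; first by case: (bit_triple hu).
  apply/has_iotaP; exists v; first by case: (bit_triple hv).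
  by rewrite hu hv yE eqxx.
- move=> [u hu hv]; do 5 (apply/orP; right).
  have := leq_npair (godel p) (godel q); rewrite /npair => hpq.
  apply/orP; left; apply/has_iotaP; exists (godel p); first by rewrite /=; lia.
  apply/has_iotaP; exists (godel q); first by rewrite /=; lia.
  rewrite eqxx andTb; apply/orP; right; apply/orP; left.
  apply/has_iotaP; exists u; first by case: (bit_triple hu).
  by rewrite hu hv.
- move=> h; do 5 (apply/orP; right).
  have := leq_npair (godel p) (godel q); rewrite /npair => hpq.
  apply/orP; left; apply/has_iotaP; exists (godel p); first by rewrite /=; lia.
  apply/has_iotaP; exists (godel q); first by rewrite /=; lia.
  rewrite eqxx !andTb; apply/orP; right; apply/orP; right.
  move: h; rewrite /derivable; case: (nsnd x) => [//|k] [u hu hv].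
  apply/has_iotaP; exists u; first by case: (bit_triple hu).
  by apply/andP.
- move=> [h h']; do 6 (apply/orP; right).
  apply/has_iotaP; exists (godel p); first by rewrite /=; lia.
  rewrite eqxx andTb; apply/andP; split=> //.
  apply/all_iotaP => k /h'[u hu]; apply/has_iotaP; exists u => //.
  by case: (bit_triple hu); lia.
Qed.

(** Claims cannot support one another in a circle: each rests on proper subprograms or, for [PPrec],
    also on the same program at a smaller recursion argument. Hence an induction on [p] with an
    inner one on [nsnd x]. *)
Lemma derivable_sound A l (P : program -> nat -> nat -> Prop) :
  (forall p x y, P p x y -> derivable A l P p x y) ->
  forall p x y, P p x y -> run A p x y.
Proof.
move=> hP; elim=> [|||||p IHp q IHq|p IHp q IHq|p IHp q IHq|p IHp] x y h;
  have := hP _ _ _ h => //=.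
- by case.
- by move=> [u [v [hu hv yE]]]; exists u, v; split=> //; [exact: IHp|exact: IHq].
- by move=> [u hu hv]; exists u; [exact: IHq|exact: IHp].
- move=> _; rewrite -/(nfst x) -/(nsnd x).
  move: h; rewrite -[in P _ _ _](npair_eta x); move: (nfst x) => a.
  elim: (nsnd x) y => [|k IHk] y h;
    have /= := hP _ _ _ h; rewrite nsnd_pair nfst_pair; first exact: IHp.
  by move=> [u hu hv]; exists u; [exact: IHk|exact: IHq].
- move=> [h0 hlt]; split=> [|k /hlt[u hu]]; first exact: IHp.
  by exists u; exact: IHp.
Qed.

Lemma derivable_mono A A' l l' (P P' : program -> nat -> nat -> Prop) p x y :
  l <= l' -> (forall z, z < l -> A z = A' z) ->
  (forall p x y, P p x y -> P' p x y) ->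
  derivable A l P p x y -> derivable A' l' P' p x y.
Proof.
move=> ll AA' PP'; case: p => //= [|p q|p q|p q|p].
- by move=> [xl ->]; rewrite AA'//; split=> //; exact: leq_trans ll.
- by move=> [u [v [/PP' hu /PP' hv ->]]]; exists u, v.
- by move=> [u /PP' hu /PP' hv]; exists u.
- by case: (nsnd x) => [/PP'//|k] [u /PP' hu /PP' hv]; exists u.
- by move=> [/PP' h0 h]; split=> // k /h[u /PP' hu]; exists u.
Qed.

Definition claims (s : seq nat) (p : program) (x y : nat) : Prop :=
  <<godel p, <<x, y>>>> \in s.

(** Lists are used because certificates are merged by concatenation; [converges_complete] turns them
    into numbers. Oracle queries stay below [l]. *)
Definition certificate A l (s : seq nat) : Prop :=
  forall p x y, claims s p x y -> derivable A l (claims s) p x y.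

Lemma certificate_cat A l s l' s' : certificate A l s -> certificate A l' s' ->
  certificate A (maxn l l') (s ++ s').
Proof.
move=> h h' p x y; rewrite {1}/claims mem_cat => /orP[/h|/h'];
  apply: derivable_mono; rewrite ?leq_maxl ?leq_maxr// => q u v;
  by rewrite /claims mem_cat => ->; rewrite ?orbT.
Qed.

Lemma certificate_cons A l s p x y : certificate A l s ->
  derivable A l (claims s) p x y ->
  certificate A l (<<godel p, <<x, y>>>> :: s).
Proof.
move=> hs hp q u v; rewrite {1}/claims inE => /orP[/eqP|/hs].
  move=> /npair_inj[/godel_inj -> /npair_inj[-> ->]].
  apply: derivable_mono hp => // p' x' y'.
  by rewrite /claims inE => ->; rewrite orbT.
apply: derivable_mono => // p' x' y'.
by rewrite /claims inE => ->; rewrite orbT.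
Qed.

(** Concatenation merges finitely many certificates. [Q k] records which claim is wanted for [k];
    this serves both the arguments below a minimum and convergence on an initial segment. *)
Lemma certificate_bounded A (Q : nat -> program * nat * nat -> Prop) n :
  (forall k, k < n -> exists l s p x y,
     [/\ certificate A l s, claims s p x y & Q k (p, x, y)]) ->
  exists l s, certificate A l s /\
    forall k, k < n -> exists p x y, claims s p x y /\ Q k (p, x, y).
Proof.
elim: n => [|n IHn] h; first by exists 0, [::]; split.
have [k kn|l [s [cs hs]]] := IHn; first by apply: h; exact: ltnW.
have [l' [s' [p [x [y [cs' cp Qp]]]]]] := h n (ltnSn n).
exists (maxn l l'), (s ++ s'); split; first exact: certificate_cat.
move=> k; rewrite ltnS leq_eqVlt => /predU1P[->|/hs[q [u [v [cq Qq]]]]].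
  by exists p, x, y; split=> //; rewrite /claims mem_cat cp orbT.
by exists q, u, v; split=> //; rewrite /claims mem_cat cq.
Qed.

Lemma certificate_complete A p x y : run A p x y ->
  exists l s, certificate A l s /\ claims s p x y.
Proof.
have add l s q u v : certificate A l s -> derivable A l (claims s) q u v ->
    exists l s, certificate A l s /\ claims s q u v.
  move=> cs ds; exists l, (<<godel q, <<u, v>>>> :: s).
  by split; [exact: certificate_cons|rewrite /claims inE eqxx].
have c0 l : certificate A l [::] by [].
have catl s s' q u v : claims s q u v -> claims (s ++ s') q u v.
  by rewrite /claims mem_cat => ->.
have catr s s' q u v : claims s' q u v -> claims (s ++ s') q u v.
  by rewrite /claims mem_cat orbC => ->.
elim: p x y => [|||||p IHp q IHq|p IHp q IHq|p IHp q IHq|p IHp] x y.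
- by move=> h; exact: (add 0 [::]).
- by move=> h; exact: (add 0 [::]).
- by move=> h; exact: (add 0 [::]).
- by move=> h; exact: (add 0 [::]).
- by move=> h; exact: (add x.+1 [::]).
- move=> [u [v [/IHp[l [s [cs hs]]] /IHq[l' [s' [cs' hs']]] yE]]].
  apply: (add _ _ _ _ _ (certificate_cat cs cs')).
  by exists u, v; split=> //; [exact: catl|exact: catr].
- move=> [u /IHq[l [s [cs hs]]] /IHp[l' [s' [cs' hs']]]].
  apply: (add _ _ _ _ _ (certificate_cat cs cs')).
  by exists u; [exact: catl|exact: catr].
- rewrite -{2}(npair_eta x) /= -/(nfst x) -/(nsnd x); move: (nfst x) => a.
  elim: (nsnd x) y => [|k IHk] y.
    move=> /IHp[l [s [cs hs]]]; apply: (add _ _ _ _ _ cs).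
    by rewrite /= nsnd_pair nfst_pair.
  move=> [u /IHk[l [s [cs hs]]] /IHq[l' [s' [cs' hs']]]].
  apply: (add _ _ _ _ _ (certificate_cat cs cs')).
  rewrite /= nsnd_pair nfst_pair.
  by exists u; [exact: catl|exact: catr].
- move=> [/IHp[l [s [cs hs]]] h].
  have [|l' [s' [cs' hs']]] := @certificate_bounded A
    (fun k z => exists u, z = (p, <<x, k>>, u.+1)) y.
    move=> k /h[u /IHp[l' [s' [cs' hs']]]].
    by exists l', s', p, <<x, k>>, u.+1; split=> //; exists u.
  apply: (add _ _ _ _ _ (certificate_cat cs cs')); split; first exact: catl.
  move=> k /hs'[p' [x' [y' [hp [u [ep ex ey]]]]]]; subst p' x' y'.
  by exists u; exact: catr.
Qed.

Definition join (X C : nat -> bool) (z : nat) : bool :=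
  if nfst z == 0 then X (nsnd z) else C z.

Lemma query_code_bits X C l z : z < l ->
  query (code_bits l X) (code_bits l C) z = join X C z.
Proof.
move=> zl; rewrite /query /join !bit_code zl; case: eqP => // _.
have := leq_npair (nfst z) (nsnd z); rewrite npair_eta => -[_ h].
by rewrite (leq_ltn_trans h zl).
Qed.

Lemma validP r c l S : valid r c l S <-> forall p x y,
  bit S <<godel p, <<x, y>>>> ->
  derivable (query r c) l (fun p x y => bit S <<godel p, <<x, y>>>>) p x y.
Proof.
split=> [/all_iotaP h p x y hb|h].
  have := h _ (bit_lt hb); rewrite hb /= !(nfst_pair, nsnd_pair).
  by move/stepP.
apply/all_iotaP => z _; apply/implyP.
have [p pE] := godel_surj (nfst z).
rewrite -{1}(npair_eta z) -{1}(npair_eta (nsnd z)) -pE => hb.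
by apply/stepP/h.
Qed.

(** A value claimed in a certificate [S] is below [S], hence below [w]: the bound on certificates
    also bounds the values of [p]. Through this, search time comes to bound values. *)
Lemma converges_sound X C l w p N :
  converges (code_bits l X) (code_bits l C) l w (godel p) N ->
  forall n, n <= N -> exists2 y, y < w & run (join X C) p n y.
Proof.
move=> /has_iotaP[S Sw /andP[/validP vS /all_iotaP hS]] n nN.
have /has_iotaP[y yS hy] := hS n nN.
exists y; first exact: ltn_trans Sw.
apply: (@derivable_sound (join X C) l
  (fun p x y => bit S <<godel p, <<x, y>>>>) _ p n y hy).
move=> q u v /vS.
by case: q => //= -[nl ->]; split=> //; rewrite query_code_bits.
Qed.

Lemma converges_complete X C p N :
  (forall n, n <= N -> exists y, run (join X C) p n y) ->
  exists k, forall l w, k <= l -> k <= w ->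
    converges (code_bits l X) (code_bits l C) l w (godel p) N.
Proof.
move=> h.
have [|l0 [s [cs hs]]] := @certificate_bounded (join X C)
    (fun k z => exists y, z = (p, k, y)) N.+1.
  move=> k /h[y /certificate_complete[l [s [cs hs]]]].
  by exists l, s, p, k, y; split=> //; exists y.
pose n := (\max_(z <- s) z).+1.
have nP z : z \in s -> z < n by move=> zs; rewrite ltnS; exact: leq_bigmax_seq.
pose S := code_bits n (mem s).
have SE z : bit S z = (z \in s).
  by rewrite bit_code; apply: andb_idl => /nP.
exists (maxn l0 S.+1) => l w; rewrite !geq_max => /andP[l0l _] /andP[_ Sw].
apply/has_iotaP; exists S => //; apply/andP; split.
  apply/validP => q x y; rewrite SE => /cs.
  case: q => //= [|q q'|q q'|q q'|q].
  - move=> [xl ->]; have xl' := leq_trans xl l0l.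
    by split=> //; rewrite query_code_bits.
  - by move=> [u [v [hu hv ->]]]; exists u, v; rewrite !SE.
  - by move=> [u hu hv]; exists u; rewrite SE.
  - by case: (nsnd x) => [|k]; rewrite ?SE// => -[u hu hv]; exists u; rewrite SE.
  - by move=> [h0 h1]; rewrite SE; split=> // k /h1[u hu]; exists u; rewrite SE.
apply/all_iotaP => k /hs[q [x [y [hq [y' [qp xk _]]]]]]; subst q x.
have hb : bit S <<godel p, <<k, y>>>> by rewrite SE.
by apply/has_iotaP; exists y => //; case: (bit_triple hb).
Qed.

Lemma converges_mono r c r' c' l l' w w' p N N' :
  l <= l' -> w <= w' -> N' <= N ->
  (forall z, z < l -> query r c z = query r' c' z) ->
  converges r c l w p N -> converges r' c' l' w' p N'.
Proof.
move=> ll ww NN qq /has_iotaP[S Sw /andP[/validP vS /all_iotaP hS]].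
apply/has_iotaP; exists S; first exact: leq_trans ww.
apply/andP; split; last by apply/all_iotaP => n nN; apply: hS; lia.
by apply/validP => q x y /vS; exact: derivable_mono.
Qed.

(** * Conditions, greedy searches and the waiting scheme *)

(* A condition is coded as [<<c, <<l, w>>>>]: a length [l], bits [c] below [l],
   and a bound [w] on certificates. Beyond the length of the condition that it
   extends, an extension must take the value [bit d n] on each column
   [n <= k]. *)
Definition cond_bits (u : nat) : nat := nfst u.
Definition cond_len (u : nat) : nat := nfst (nsnd u).
Definition cond_bound (u : nat) : nat := nsnd (nsnd u).

Definition extends (k d t u : nat) : bool :=
  (cond_len t <= cond_len u) &&
  all (fun z => if z < cond_len t
                then bit (cond_bits u) z == bit (cond_bits t) z
                else (nfst z <= k) ==> (bit (cond_bits u) z == bit d (nfst z)))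
    (iota 0 (cond_len u)).

Definition mass (p u N : nat) : nat :=
  count (fun r => converges r (cond_bits u) (cond_len u) (cond_bound u) p N)
    (iota 0 (2 ^ cond_len u)).

(* The index [<<p, <<t0, <<<<k, d>>, <<a, b>>>>>>>>] stands for the greedy
   search for conditions [t0], [t1], ... such that each [t_i.+1] extends [t_i]
   and makes [p] converge up to [i] for a fraction at least [a / b] of the
   oracles. *)
Definition idx_root (e : nat) : nat := nfst (nsnd e).

Definition good (e N t u : nat) : bool :=
  extends (nfst (nfst (nsnd (nsnd e)))) (nsnd (nfst (nsnd (nsnd e)))) t u &&
  (nfst (nsnd (nsnd (nsnd e))) * 2 ^ cond_len u <=
   nsnd (nsnd (nsnd (nsnd e))) * mass (nfst e) u N).

(** The state is [<<i, <<t, u>>>>]: the argument [i] being treated, the current condition [t] and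
    the candidate [u] for the next one. One candidate is tested per step. *)
Definition tick (e st : nat) : nat :=
  if good e (nfst st) (nfst (nsnd st)) (nsnd (nsnd st))
  then <<(nfst st).+1, <<nsnd (nsnd st), 0>>>>
  else <<nfst st, <<nfst (nsnd st), (nsnd (nsnd st)).+1>>>>.

Definition search (e s : nat) : nat := iter s (tick e) <<0, <<idx_root e, 0>>>>.

Definition found (e n s : nat) : bool := n < nfst (search e s).

(* [track e n = <<k, n'>>]: by time [n], [k] awaited convergences of the search
   [e] have occurred, and the next one awaited is at argument [n']. *)
Definition track (e n : nat) : nat :=
  iteri n (fun i st =>
    if found e (nsnd st) i then <<(nfst st).+1, i.+1>> else st) <<0, e>>.

(* Those [Y] whose first [e.+2] bits are the low bits of [k] wait for the
   [k]-th awaited convergence of the search [e]. *)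
Definition holds (Y : nat -> bool) (e n : nat) : bool :=
  (nsnd (track e n) == n) &&
  all (fun j => Y j == bit (nfst (track e n)) j) (iota 0 e.+2).

(** Restricting to [e <= n] makes the test finite and omits nothing, since [track e] starts waiting
    at argument [e]. *)
Definition pass (Y : nat -> bool) (n s : nat) : bool :=
  all (fun e => holds Y e n ==> found e n s) (iota 0 n.+1).

Lemma computable_found A e n s : computable_from A e -> computable_from A n ->
  computable_from A s -> computable_from A (fun x => found (e x) (n x) (s x)).
Proof.
move=> ce cn cs; rewrite /found; apply: computable_leq; first by computable.
apply: computable_fst; apply: computable_iter => //.
  by rewrite /idx_root; computable.
have conv r c l w p N := @computable_converges A r c l w p N.
rewrite /tick /good /extends /mass /cond_len /cond_bits /cond_bound.
by computable; apply: conv; computable.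
Qed.

Lemma computable_pass Y : computable_from Y (fun z => pass Y (nfst z) (nsnd z)).
Proof.
have ctrack e n : computable_from Y e -> computable_from Y n ->
    computable_from Y (fun x => track (e x) (n x)).
  move=> ce cn; apply: computable_iteri => //; first by computable.
  by apply: computable_if; first apply: computable_found; computable.
rewrite /pass /holds; computable.
- by apply: ctrack; computable.
- by apply: ctrack; computable.
- by apply: computable_found; computable.
Qed.

(** * Progress of searches and the escape function *)

Lemma tick_mono e st : nfst st <= nfst (tick e st).
Proof. by rewrite /tick; case: ifP; rewrite nfst_pair. Qed.

Lemma search_mono e s s' : s <= s' -> nfst (search e s) <= nfst (search e s').
Proof.
move=> /subnK <-; elim: (s' - s) => // n IHn.
by rewrite addSn; exact: leq_trans IHn (tick_mono _ _).
Qed.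

Lemma found_mono e n s s' : s <= s' -> found e n s -> found e n s'.
Proof. by move=> /(search_mono e) h h'; exact: leq_trans h' h. Qed.

Lemma found_lt e n s : found e n s -> n < s.
Proof.
rewrite /found => /leq_trans; apply.
elim: s => [|s IHs]; first by rewrite /search /= nfst_pair.
rewrite [search e s.+1]/(tick e (search e s)) /tick.
by case: ifP; rewrite nfst_pair; lia.
Qed.

Lemma trackS e n : track e n.+1 =
  if found e (nsnd (track e n)) n then <<(nfst (track e n)).+1, n.+1>>
  else track e n.
Proof. by []. Qed.

Lemma track_start e n : n <= e -> track e n = <<0, e>>.
Proof.
elim: n => // n IHn ne; rewrite trackS IHn; last exact: ltnW.
by rewrite nsnd_pair; case: ifP => // /found_lt; lia.
Qed.

Lemma track_wait e n m : nsnd (track e n) = n -> n <= m ->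
  (forall s, s < m -> ~~ found e n s) -> track e m = track e n.
Proof.
move=> en /subnK <-; elim: (m - n) => // k IHk h; rewrite addSn trackS IHk.
  by rewrite en (negbTE (h _ _)).
by move=> s sk; apply: h; lia.
Qed.

(** Each convergence awaited from a total search occurs at a least time [s], and the next wait is
    set at [s.+1]; so the counter passes through every [k]. *)
Lemma track_total e : (forall n, exists s, found e n s) ->
  forall k, exists n, [/\ track e n = <<k, n>>, k <= n & e <= n].
Proof.
move=> h; elim=> [|k [n [en kn le]]]; first by exists e; rewrite track_start.
case: (ex_minnP (h n)) => s fs smin.
have ns := found_lt fs.
exists s.+1; split; [|lia|lia].
have es : track e s = track e n.
  apply: track_wait; rewrite ?en ?nsnd_pair//; first exact: ltnW.
  by move=> i si; apply/negP => /smin; lia.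
by rewrite trackS es en nsnd_pair nfst_pair fs.
Qed.

Definition escaping (Y : nat -> bool) : Prop := forall n, exists s, pass Y n s.

Definition least (P : pred nat) : nat :=
  if pselect (exists n, P n) is left h then ex_minn h else 0.

Lemma leastP (P : pred nat) : (exists n, P n) ->
  P (least P) /\ forall k, k < least P -> ~~ P k.
Proof.
rewrite /least => h; case: pselect => // h'.
case: ex_minnP => m Pm mmin; split=> // k km.
by apply/negP => /mmin; lia.
Qed.

Definition escape (Y : nat -> bool) (n : nat) : nat := least (pass Y n).

Lemma computable_escape Y : escaping Y -> computable_from Y (escape Y).
Proof.
move=> tY; apply: (computable_min (computable_pass Y)) => n.
exact: leastP.
Qed.

Lemma escapeP e Y m : (forall n, exists s, found e n s) -> escaping Y ->
  exists2 n, m < n & found e n (escape Y n).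
Proof.
move=> he tY.
(* [k] copies the first [e.+2] bits of [Y], so [Y] waits for the [k]-th convergence; the ones placed
   above them make [k] exceed [m]. *)
pose k := code_bits (e.+3 + m) (fun j => if j < e.+2 then Y j else true).
have bk j : bit k j = (j < e.+3 + m) && (if j < e.+2 then Y j else true).
  exact: bit_code.
have mk : m < k.
  have : bit k (e.+2 + m) by rewrite bk; case: ifP; lia.
  by move/bit_lt; lia.
have [n [en kn le]] := track_total he k.
exists n; first exact: leq_trans mk kn.
have [/all_iotaP/(_ e)+ _] := leastP (tY n).
rewrite ltnS le => /(_ isT)/implyP; apply.
rewrite /holds en nsnd_pair eqxx nfst_pair; apply/all_iotaP => j je.
by rewrite bk je; have -> : j < e.+3 + m by lia.
Qed.

Lemma not_escaping Y : ~ escaping Y -> exists e n,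
  holds Y e n /\ forall s, ~~ found e n s.
Proof.
move=> /existsNP[n hn]; apply: contrapT => h; apply: hn.
suff [s hs] : exists s, forall e, e < n.+1 -> holds Y e n -> found e n s.
  by exists s; apply/all_iotaP => e en; apply/implyP/hs.
elim: n.+1 => [|k [s IHk]]; first by exists 0.
have [hk|hk] := boolP (holds Y k n); last first.
  exists s => e; rewrite ltnS leq_eqVlt => /predU1P[->|]; last exact: IHk.
  by rewrite (negbTE hk).
have [s' hs'] : exists s, found k n s.
  apply: contrapT => h'; apply: h; exists k, n; split=> // s0.
  by apply/negP => fs; apply: h'; exists s0.
exists (maxn s s') => e; rewrite ltnS leq_eqVlt => /predU1P[->|ek /(IHk _ ek)].
  by move=> _; apply: found_mono hs'; exact: leq_maxr.
by apply: found_mono; exact: leq_maxl.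
Qed.

Definition stuck (e : nat) : nat :=
  least (fun k => `[< exists n, track e n = <<k, n>> /\ forall s, ~~ found e n s >]).

(* Only the condition awaited last by a diverging search can block [escape], so
   each search costs at most one cylinder. *)
Lemma not_escaping_cylinder Y : ~ escaping Y ->
  exists e, cylinder (mkseq (bit (stuck e)) e.+2) Y.
Proof.
move=> /not_escaping[e [n [/andP[/eqP en /all_iotaP hY] nf]]]; exists e => i.
rewrite size_mkseq => ie; rewrite nth_mkseq// (eqP (hY i ie)).
have [|/asboolP[n' [en' nf']] _] := @leastP (fun k => `[< exists n,
    track e n = <<k, n>> /\ forall s, ~~ found e n s >]).
  exists (nfst (track e n)); apply/asboolP; exists n.
  by rewrite -[X in <<_, X>>]en npair_eta.
congr (bit _ i); rewrite -/(stuck e) in en' *.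
(* Both [n] and [n'] are awaited forever, so the track is constant from the smaller of them on and
   the counters agree. *)
have [nn|nn] := leqP n n'.
  rewrite -(@track_wait e n n')//.
  by rewrite en' nfst_pair.
rewrite (@track_wait e n' n) ?en' ?nsnd_pair ?nfst_pair//.
exact: ltnW.
Qed.

(** * Extension of conditions and success of the greedy search *)

Lemma extendsP k d t u : reflect (cond_len t <= cond_len u /\
    forall z, z < cond_len u ->
      if z < cond_len t then bit (cond_bits u) z = bit (cond_bits t) z
      else nfst z <= k -> bit (cond_bits u) z = bit d (nfst z))
  (extends k d t u).
Proof.
apply: (iffP andP) => -[tu h]; split=> //.
  move=> z zu; move/all_iotaP: h => /(_ z zu).
  by case: ifP => _ => [/eqP//|/implyP h /h/eqP].
apply/all_iotaP => z /h; case: ifP => _ => [->//|hz].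
by apply/implyP => /hz ->.
Qed.

Lemma extends_refl k d t : extends k d t t.
Proof. by apply/extendsP; split=> // z ->. Qed.

Lemma extends_trans k d t u v : extends k d t u -> extends k d u v ->
  extends k d t v.
Proof.
move=> /extendsP[tu hu] /extendsP[uv hv]; apply/extendsP.
split=> [|z zv]; first exact: leq_trans uv.
have := hv z zv; case: ifP => [zu ->|zu].
  exact: hu.
by rewrite ifN// -leqNgt (leq_trans tu)// leqNgt zu.
Qed.

Section Search.
Variable e : nat.
Local Notation k := (nfst (nfst (nsnd (nsnd e)))).
Local Notation d := (nsnd (nfst (nsnd (nsnd e)))).
Hypothesis good_exists :
  forall t N, extends k d (idx_root e) t -> exists u, good e N t u.

Fixpoint found_cond (N : nat) : nat :=
  if N is M.+1 then least (good e M (found_cond M)) else idx_root e.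

Lemma found_condP N : extends k d (idx_root e) (found_cond N) /\
  good e N (found_cond N) (found_cond N.+1).
Proof.
have step_good M : extends k d (idx_root e) (found_cond M) ->
    good e M (found_cond M) (found_cond M.+1).
  by move=> h; have [] := leastP (good_exists M h).
elim: N => [|N [eN gN]]; first by split; [|apply: step_good]; exact: extends_refl.
have [ext _] := andP gN.
by split; [|apply: step_good]; exact: extends_trans ext.
Qed.

(** Time at which the search turns to argument [N]: for each earlier argument the candidates from 0
    up to the one found have cost one step each, whence the successor. *)
Fixpoint found_time (N : nat) : nat :=
  if N is M.+1 then (found_time M + found_cond N).+1 else 0.

Lemma search_found N j : j <= found_cond N.+1 ->
  search e (found_time N + j) = <<N, <<found_cond N, j>>>>.
Proof.
have tickE s : search e s.+1 = tick e (search e s) by [].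
elim: N j => [|N IHN]; elim=> [|j IHj] jN.
- by [].
- rewrite addnS tickE IHj; last exact: ltnW.
  rewrite /tick !(nfst_pair, nsnd_pair).
  have [_ /(_ j jN)/negbTE ->//] := leastP (good_exists 0 (found_condP 0).1).
- rewrite addn0 tickE IHN// /tick !(nfst_pair, nsnd_pair).
  by rewrite (found_condP N).2.
- rewrite addnS tickE IHj; last exact: ltnW.
  rewrite /tick !(nfst_pair, nsnd_pair).
  have [_ /(_ j jN)/negbTE ->//] := leastP (good_exists N.+1 (found_condP N.+1).1).
Qed.

Lemma found_total n : exists s, found e n s.
Proof.
exists (found_time n.+1); rewrite /found -[found_time n.+1]addn0.
by rewrite search_found// nfst_pair.
Qed.

(** Candidates are tried in the order 0, 1, 2, ..., one per step, so finding a condition takes at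
    least as many steps as its code. The certificate bound of a condition is at most its code, so
    search time bounds the values it forces. *)
Lemma found_cond_le n s : found e n s -> found_cond n.+1 <= s.
Proof.
rewrite leqNgt; apply: contraL => lt.
have le : s <= found_time n + found_cond n.+1 by lia.
by rewrite /found -leqNgt (leq_trans (search_mono e le))// search_found// nfst_pair.
Qed.

End Search.

(** * The jump and limits of columns *)

Fixpoint const_program (m : nat) : program :=
  if m is n.+1 then PComp PSucc (const_program n) else PZero.

Lemma run_const_program A m x : run A (const_program m) x m.
Proof. by elim: m => //= m IHm; exists m. Qed.

(** The jump runs a program on its own code; composing with a constant program replaces that input
    by [m]. *)
Lemma jump_comp_const A p m :
  jump A (godel (PComp p (const_program m))) <-> exists y, run A p m y.
Proof.
split=> [/asboolP[q [/godel_inj -> [y [u hu pu]]]]|[y py]].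
  by exists y; rewrite (run_functional (run_const_program A m _) hu).
apply/asboolP; exists (PComp p (const_program m)); split=> //.
by exists y, m => //; exact: run_const_program.
Qed.

Lemma computable_jump A p f : computable_from (jump A) f ->
  computable_from (jump A)
    (fun x => jump A (godel (PComp p (const_program (f x))))).
Proof.
(* [PSucc] has code 1 and [PComp] the tag 6, so the code of [const_program] is an iterate. *)
move=> cf; apply: (@computable_ext _ (fun x => jump A
    (6 + 4 * <<godel p, iter (f x) (fun g => 6 + 4 * <<1, g>>) 0>>))) => [x|].
  suff -> : iter (f x) (fun g => 6 + 4 * <<1, g>>) 0 =
    godel (const_program (f x)) by [].
  by elim: (f x) => //= n ->.
apply: computable_oracle; computable.
by apply: computable_iter => //; computable.
Qed.

(* The jump of [B] decides whether column [n.+1] still takes a given value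
   beyond [s]; searching for an [s] where one of the two values is excluded
   yields the limit. *)
Lemma limit_le_jump (B D : nat -> bool) :
  (forall n, exists s, forall t, s <= t -> B <<n.+1, t>> = D n) ->
  turing_le D (jump B).
Proof.
move=> lim.
have [q hq] : exists q : bool -> program, forall b n s,
    (exists y, run B (q b) <<n, s>> y) <-> exists t, B <<n.+1, s + t>> = b.
  suff : forall b, exists q, forall n s,
      (exists y, run B q <<n, s>> y) <-> exists t, B <<n.+1, s + t>> = b.
    by move=> /boolp.choice[q hq]; exists q.
  move=> b.
  have [r hr] : computable_from B (fun z =>
      ~~ (B <<(nfst (nfst z)).+1, nsnd (nfst z) + nsnd z>> == b)) by computable.
  exists (PMin r) => n s; split=> [[y [h0 _]]|ex].
    exists y; apply/eqP; rewrite -[_ == _]negbK.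
    have := run_functional h0 (hr _); rewrite !(nfst_pair, nsnd_pair).
    by case: (_ == _).
  have ex' : exists t, B <<n.+1, s + t>> == b.
    by have [t /eqP ht] := ex; exists t.
  case: (ex_minnP ex') => t bt tmin; exists t; split.
    by have := hr <<<<n, s>>, t>>; rewrite !(nfst_pair, nsnd_pair) bt.
  move=> k kt; exists 0.
  have := hr <<<<n, s>>, k>>; rewrite !(nfst_pair, nsnd_pair).
  by case: eqP => // /eqP/tmin; lia.
pose H b n s := jump B (godel (PComp (q b) (const_program <<n, s>>))).
have HP b n s : reflect (exists t, B <<n.+1, s + t>> = b) (H b n s).
  by apply: (iffP idP) => [/jump_comp_const/hq|/hq/jump_comp_const].
have cH b f g : computable_from (jump B) f -> computable_from (jump B) g ->
    computable_from (jump B) (fun x => H b (f x) (g x)).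
  by move=> cf cg; apply: computable_jump; computable.
have ex n : exists s, ~~ (H true n s && H false n s).
  have [s hs] := lim n; exists s; apply/negP => /andP[/HP[t ht] /HP[t' ht']].
  by move: ht ht'; rewrite !hs ?leq_addr// => ->.
pose f n := least (fun s => ~~ (H true n s && H false n s)).
have cf : computable_from (jump B) f.
  apply: (@computable_min _ (fun n s => ~~ (H true n s && H false n s))).
    by computable; apply: cH; computable.
  by move=> n; exact: leastP.
apply: (@computable_ext _ (fun n => H true n (f n))) => [n|]; last first.
  by apply: cH => //; computable.
congr nat_of_bool; have [s hs] := lim n.
(* One of the two values is excluded beyond [f n]; it is not the limit, which is still attained at
   [f n + s]. *)
have DE : B <<n.+1, f n + s>> = D n by rewrite hs// leq_addl.
have [+ _] := leastP (ex n); rewrite -/(f n) negb_and.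
have [/HP _ /HP h|h _] := boolP (H true n (f n)).
  by case: (D n) DE => // DE; case: h; exists s.
by case: (D n) DE => // DE; case/HP: h; exists s.
Qed.

(** * Estimates in a probability space *)

Section Probability.
Context d (T : measurableType d) (R : realType).
Variable mu : probability T R.
Local Open Scope classical_set_scope.

(** A form of Fatou's lemma: the tail intersections increase to the union, and each lies inside some
    [W l] with [l0 <= l]. *)
Lemma measure_liminf_le (W : nat -> set T) (c : R) l0 :
  (forall l, measurable (W l)) -> (forall l, l0 <= l -> (mu (W l) <= c%:E)%E) ->
  measurable (\bigcup_n \bigcap_(l in [set l | (n <= l)%N]) W l) /\
  (mu (\bigcup_n \bigcap_(l in [set l | (n <= l)%N]) W l) <= c%:E)%E.
Proof.
move=> mW hW; pose G n := \bigcap_(l in [set l | (n <= l)%N]) W l.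
have mG n : measurable (G n) by exact: bigcap_measurableType.
have mGU : measurable (\bigcup_n G n) by exact: bigcupT_measurable.
split=> //.
have ndG : nondecreasing_seq G.
  move=> n n' nn'; apply/subsetPset => X h l /= n'l; apply: h => /=.
  exact: leq_trans n'l.
have cG := nondecreasing_cvg_mu mG mGU ndG (mu := mu).
rewrite -(cvg_lim _ cG)//; apply: lime_le; first by apply: cvgP cG.
apply: nearW => n; apply: le_trans (hW (maxn n l0) (leq_maxr _ _)).
apply: le_measure; rewrite ?inE//.
by move=> X; apply; rewrite /= leq_maxl.
Qed.

(** Continuity from above at the empty set. *)
Lemma measure_bigcap_small (V : nat -> set T) (c : R) :
  (forall n, measurable (V n)) -> nonincreasing_seq V -> (0 < c)%R ->
  \bigcap_n V n = set0 -> exists n, (mu (V n) <= c%:E)%E.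
Proof.
move=> mV niV c0 V0; apply: contrapT => h.
have lt n : (c%:E <= mu (V n))%E.
  by rewrite leNgt; apply/negP => /ltW le; apply: h; exists n.
have mI : measurable (\bigcap_n V n) by rewrite V0.
have fin : (mu (V 0%N) < +oo)%E by rewrite ltey_eq fin_num_measure.
have cV := nonincreasing_cvg_mu fin mV mI niV.
have : (c%:E <= lim (mu \o V @ \oo))%E.
  by apply: lime_ge; [apply: cvgP cV|exact: nearW].
by rewrite (cvg_lim _ cV)// V0 measure0 lee_fin leNgt c0.
Qed.

Local Open Scope ring_scope.

Lemma measure_fin_num (V : set T) : measurable V -> mu V \is a fin_num.
Proof. by move=> mV; rewrite fin_num_measure. Qed.

Lemma le0_half_powers (x : \bar R) :
  (forall i, (x <= (2 ^- i)%:E)%E) -> (x <= 0)%E.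
Proof.
move=> h; apply/lee_addgt0Pr => e e0; rewrite add0e.
apply: le_trans (h (Num.bound e^-1)) _; rewrite lee_fin.
rewrite invf_ple ?posrE ?exprn_gt0// ltW//.
exact: upper_nthrootP.
Qed.

Lemma negligible_half_powers (A : set T) :
  (forall i, exists V : set T,
     [/\ measurable V, A `<=` V & (mu V <= (2 ^- i)%:E)%E]) ->
  mu.-negligible A.
Proof.
move=> /boolp.choice[V hV]; exists (\bigcap_i V i).
have mV i : measurable (V i) by have [] := hV i.
have mI : measurable (\bigcap_i V i) by exact: bigcapT_measurable.
split=> //; last by move=> X AX i _; have [_ h _] := hV i; exact: h.
apply/eqP; rewrite eq_le measure_ge0 andbT; apply: le0_half_powers => i.
have [_ _] := hV i; apply: le_trans; apply: le_measure; rewrite ?inE//.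
exact: bigcap_inf.
Qed.

(** Markov's inequality for the weighted sum of indicators, whose mean is at most [c] because the
    weights sum to at most 1. *)
Lemma weighted_markov n (E : nat -> set T) (beta : nat -> R) (c a : R) :
  (forall i, measurable (E i)) -> (forall i, 0 <= beta i) ->
  \sum_(i < n) beta i <= 1 -> (forall i, (mu (E i) <= c%:E)%E) -> 0 < a ->
  exists Bad : set T, [/\ measurable Bad, (mu Bad <= (c / a)%:E)%E &
    forall X, ~ Bad X -> \sum_(i < n) beta i * \1_(E i) X <= a].
Proof.
move=> mE b0 b1 Ec a0.
pose h (X : T) : \bar R := (\sum_(i < n) (beta i * \1_(E i) X)%:E)%E.
have hE X : h X = (\sum_(i < n) beta i * \1_(E i) X)%:E by rewrite /h sumEFin.
have h0 X : (0 <= h X)%E.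
  by rewrite hE lee_fin sumr_ge0// => i _; rewrite mulr_ge0.
have mterm (i : nat) : @measurable_fun _ _ T (\bar R) setT
    (fun X => (beta i * \1_(E i) X)%:E).
  apply/measurable_EFinP; apply: measurable_funM => //.
have mh : measurable_fun setT h by apply: emeasurable_sum => i; exact: mterm.
pose Bad := [set X | (a%:E <= `|h X|)%E].
have mBad : measurable Bad.
  rewrite -[Bad]setTI; apply: emeasurable_fun_c_infty => //.
  exact: measurableT_comp.
exists Bad; split=> //; last first.
  move=> X /negP; rewrite -ltNge gee0_abs// hE lte_fin; exact: ltW.
have := @le_integral_comp_abse _ _ R mu setT measurableT h a id
  (@measurable_id _ _ _) (fun _ => id) (fun _ _ _ _ => id) mh a0.
rewrite setTI -/Bad => /le_trans le.
have int_le : (\int[mu]_(X in setT) `|h X| <= c%:E)%E.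
  under eq_integral do rewrite gee0_abs//.
  rewrite ge0_integral_sum//; last first.
    by move=> i X _; rewrite lee_fin mulr_ge0.
  apply: (@le_trans _ _ (\sum_(i < n) (beta i * c)%:E)%E).
    apply: lee_sum => i _; under eq_integral do rewrite EFinM.
    rewrite ge0_integralZl_EFin//.
    - rewrite integral_indic// setIT EFinM.
      by apply: lee_wpmul2l; [rewrite lee_fin|exact: Ec].
    - exact/measurable_EFinP.
  have c0 : 0 <= c by rewrite -lee_fin; apply: le_trans (Ec 0%N).
  by rewrite sumEFin lee_fin -mulr_suml ler_piMl.
have := le _ int_le; rewrite /= -{1}(fineK (measure_fin_num mBad)) -EFinM lee_fin.
by rewrite -(fineK (measure_fin_num mBad)) lee_fin ler_pdivlMr// mulrC.
Qed.

End Probability.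

(** * Subsets of Cantor space decided by finitely many bits *)

Section CodeBits.
Local Open Scope classical_set_scope.

Lemma cylinder_code_bits l r (X : nat -> bool) : (r < 2 ^ l) ->
  cylinder (mkseq (bit r) l) X <-> code_bits l X = r.
Proof.
move=> rl; split=> [h|<- i].
  rewrite -[RHS](code_bitsK rl); apply: eq_code_bits => i il.
  by rewrite h ?size_mkseq// nth_mkseq.
by rewrite size_mkseq => il; rewrite nth_mkseq// bit_code il.
Qed.

Lemma measurable_cylinder s : measurable (cylinder s : set cantor).
Proof. by apply: sub_sigma_algebra; exists s. Qed.

Lemma measurable_prefix l (Q : set cantor) :
  (forall X X' : cantor, (forall i, (i < l) -> X i = X' i) -> Q X -> Q X') ->
  measurable Q.
Proof.
move=> h; rewrite (_ : Q = \bigcup_(r in [set r | (r < 2 ^ l) /\ Q (bit r)])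
    (cylinder (mkseq (bit r) l) : set cantor)).
  by apply: bigcup_measurable => r _; exact: measurable_cylinder.
apply/seteqP; split=> X.
  move=> QX; exists (code_bits l X).
    split; first exact: code_bits_lt.
    by apply: h QX => i il; rewrite bit_code il.
  exact/(cylinder_code_bits _ (code_bits_lt _ _)).
move=> [r [_ Qr] hX]; apply: h Qr => i il.
by rewrite hX ?size_mkseq// nth_mkseq.
Qed.

End CodeBits.

(** * Measure of convergence and critical conditions *)

Section FairCoin.
Variable R : realType.
Variable mu : probability cantor R.
Hypothesis mu_cylinder : forall s, mu (cylinder s) = ((2 ^- size s)%R : R)%:E.
Local Open Scope classical_set_scope.

Lemma measure_codes l (s : seq nat) : uniq s -> (forall r, r \in s -> (r < 2 ^ l)%N) ->
  measurable [set X : cantor | code_bits l X \in s] /\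
  mu [set X : cantor | code_bits l X \in s] = ((size s)%:R / 2 ^+ l)%R%:E.
Proof.
elim: s => [_ _|r s IHs /= /andP[rs us] lt].
  rewrite (_ : [set _ | _] = set0); last by apply/seteqP; split.
  by rewrite measure0 mul0r.
have [|ms es] := IHs us; first by move=> q qs; apply: lt; rewrite inE qs orbT.
have rl : (r < 2 ^ l)%N by apply: lt; rewrite inE eqxx.
rewrite (_ : [set _ | _] = (cylinder (mkseq (bit r) l) : set cantor) `|`
    [set X : cantor | code_bits l X \in s]); last first.
  apply/seteqP; split=> X /=; rewrite inE.
    by move=> /orP[/eqP h|]; [left; apply/(cylinder_code_bits _ rl)|right].
  by move=> [/(cylinder_code_bits _ rl) ->|->]; rewrite ?eqxx ?orbT.
have mc := measurable_cylinder (mkseq (bit r) l).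
split; first exact: measurableU.
rewrite measureU//; last first.
  apply/seteqP; split=> X // [/(cylinder_code_bits _ rl) e].
  by rewrite /= e (negbTE rs).
rewrite -natr1 mulrDl mul1r (addrC (_ / _)%R) EFinD; congr (_ + _)%E; last exact: es.
by have := mu_cylinder (mkseq (bit r) l); rewrite size_mkseq.
Qed.

(** Links measure to counting: [mass] counts prefixes, so a search can compare measures by integer
    arithmetic. *)
Lemma measure_code_bits l (P : pred nat) :
  measurable [set X : cantor | P (code_bits l X)] /\
  mu [set X : cantor | P (code_bits l X)] =
    ((count P (iota 0 (2 ^ l)))%:R / 2 ^+ l)%R%:E.
Proof.
have [|r|] := @measure_codes l [seq r <- iota 0 (2 ^ l) | P r].
- exact: filter_uniq (iota_uniq _ _).
- by rewrite mem_filter mem_iota => /and3P[].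
rewrite size_filter (_ : [set _ | _] = [set X : cantor | P (code_bits l X)])//.
apply/seteqP; split=> X /=; rewrite mem_filter mem_iota /= add0n code_bits_lt.
  by rewrite andbT.
by rewrite andbT.
Qed.

Definition converging (p u N : nat) : set cantor :=
  [set X : cantor | converges (code_bits (cond_len u) X) (cond_bits u)
                      (cond_len u) (cond_bound u) p N].

Lemma measure_converging p u N : measurable (converging p u N) /\
  mu (converging p u N) = ((mass p u N)%:R / 2 ^+ cond_len u)%R%:E.
Proof.
exact: (measure_code_bits (cond_len u)
  (fun r => converges r (cond_bits u) (cond_len u) (cond_bound u) p N)).
Qed.

Lemma mass_le p u N : mass p u N <= 2 ^ cond_len u.
Proof. by rewrite -[leqRHS](size_iota 0) count_size. Qed.

(* Choosing [a] maximal pins the attainable fraction between [a / b] and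
   [a.+1 / b] below [t]. *)
Lemma exists_critical_mass p k d t0 b : exists a t N0, [/\ extends k d t0 t,
  forall t' N, extends k d t t' ->
    exists u, extends k d t' u && (a * 2 ^ cond_len u <= b * mass p u N)
  & forall u, extends k d t u -> b * mass p u N0 < a.+1 * 2 ^ cond_len u].
Proof.
pose Q a := `[< exists t, extends k d t0 t /\ forall t' N, extends k d t t' ->
  exists u, extends k d t' u && (a * 2 ^ cond_len u <= b * mass p u N) >].
have Q0 : exists a, Q a.
  exists 0; apply/asboolP; exists t0; split; first exact: extends_refl.
  by move=> t' N _; exists t'; rewrite extends_refl.
have Qb a : Q a -> a <= b.
  move=> /asboolP[t [_ /(_ t 0 (extends_refl _ _ _))[u /andP[_ h]]]].
  have := leq_trans h (leq_mul (leqnn b) (mass_le p u 0)).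
  by rewrite leq_pmul2r// expn_gt0.
case: (ex_maxnP Q0 Qb) => a /asboolP[t [t0t ht]] amax.
have /asboolPn nQ : ~~ Q a.+1 by apply/negP => /amax; rewrite ltnn.
(* Failure at [a.+1] below [t] provides [t'] and [N0]: no extension of [t'] converges up to [N0] for
   a fraction [a.+1 / b] of the oracles. *)
have [t' [N0 [tt' h]]] : exists t' N, extends k d t t' /\
    ~ exists u, extends k d t' u && (a.+1 * 2 ^ cond_len u <= b * mass p u N).
  apply: contrapT => h; apply: nQ; exists t; split=> // t' N tt'.
  by apply: contrapT => h'; apply: h; exists t', N.
exists a, t', N0; split.
- exact: extends_trans tt'.
- by move=> t'' N h'; apply: ht; exact: extends_trans h'.
- by move=> u tu; rewrite ltnNge; apply/negP => le; apply: h; exists u; rewrite tu.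
Qed.

(** * Sets following a condition *)

Definition follows (k : nat) (D : nat -> bool) (t : nat) (C : nat -> bool) : Prop :=
  (forall z, z < cond_len t -> C z = bit (cond_bits t) z) /\
  (forall z, cond_len t <= z -> nfst z <= k -> C z = D (nfst z)).

Lemma bit_locks k D n : n <= k -> bit (code_bits k.+1 D) n = D n.
Proof. by move=> nk; rewrite bit_code ltnS nk. Qed.

Lemma follows_extends k D t u C : extends k (code_bits k.+1 D) t u ->
  follows k D u C -> follows k D t C.
Proof.
move=> /extendsP[tu h] [h1 h2]; split=> z.
  by move=> zt; rewrite h1 ?(leq_trans zt)//; have := h z; rewrite zt => ->//;
    exact: leq_trans tu.
move=> tz zk; have [zu|uz] := ltnP z (cond_len u); last exact: h2.
by rewrite h1//; have := h z zu; rewrite ltnNge tz /= => ->//; exact: bit_locks.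
Qed.

(** [l] is both the length and the certificate bound, so letting [l] grow captures every convergence
    relative to [join X C]. *)
Definition initial (C : nat -> bool) (l : nat) : nat := << code_bits l C, << l, l >> >>.

Lemma extends_initial k D t C l : follows k D t C -> cond_len t <= l ->
  extends k (code_bits k.+1 D) t (initial C l).
Proof.
move=> [h1 h2] tl; apply/extendsP; rewrite /initial /cond_len /cond_bits.
rewrite !(nfst_pair, nsnd_pair); split=> // z zl; rewrite bit_code zl /=.
case: ltnP => [/h1//|tz zk]; rewrite bit_locks//; exact: h2.
Qed.

(** * Forcing against domination by a fixed program *)

(** With [p] and the cut-off [m] fixed, domination by some function computable from [B] becomes a
    countable union of such sets. *)
Definition dominated (p : program) (m : nat) (B : nat -> bool) : set cantor :=
  [set Y | escaping Y /\ exists f, (forall n, run B p n (f n)) /\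
     forall n, m < n -> escape Y n < f n].

Lemma pass_prefix (Y Y' : nat -> bool) n : (forall i, i < n.+2 -> Y i = Y' i) ->
  pass Y n = pass Y' n.
Proof.
move=> YY; apply/funext => s; apply: eq_in_all => e.
rewrite mem_iota add0n ltnS => /= en; congr (_ ==> _); congr (_ && _).
apply: eq_in_all => i; rewrite mem_iota add0n /= => ie.
by rewrite YY//; apply: leq_trans ie _; rewrite !ltnS.
Qed.

Lemma measurable_escaping : measurable (escaping : set cantor).
Proof.
rewrite (_ : escaping = \bigcap_n \bigcup_s [set Y : cantor | pass Y n s]).
  apply: bigcapT_measurable => n; apply: bigcupT_measurable => s.
  apply: (@measurable_prefix n.+2) => Y Y' YY /=.
  by rewrite (pass_prefix YY).
apply/seteqP; split=> Y h.
  by move=> n _; have [s] := h n; exists s.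
by move=> n; have [s] := h n I; exists s.
Qed.

Lemma escape_prefix (Y Y' : nat -> bool) n : (forall i, i < n.+2 -> Y i = Y' i) ->
  escape Y n = escape Y' n.
Proof. by move=> /pass_prefix; rewrite /escape => ->. Qed.

Lemma cond_le u : cond_len u <= u /\ cond_bound u <= u.
Proof.
rewrite /cond_len /cond_bound.
have := leq_npair (nfst u) (nsnd u); rewrite npair_eta => -[_ h].
have := leq_npair (nfst (nsnd u)) (nsnd (nsnd u)); rewrite npair_eta => -[h1 h2].
by split; exact: leq_trans h.
Qed.

Lemma converging_initial p k D u C n N l : follows k D u C ->
  cond_len u <= l -> cond_bound u <= l -> N <= n ->
  converging p u n `<=` converging p (initial C l) N.
Proof.
move=> [h1 _] ul wl Nn X; rewrite /converging /initial /cond_len /cond_bits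
  /cond_bound /= !(nfst_pair, nsnd_pair).
apply: converges_mono => // z zu.
rewrite query_code_bits; last exact: leq_trans ul.
rewrite /query /join; case: eqP => z0; last by rewrite h1.
have := leq_npair (nfst z) (nsnd z); rewrite npair_eta => -[_ h].
by rewrite bit_code (leq_ltn_trans h zu).
Qed.

(** Both [u] and the longer [initial C l] extend [t]: the first has fraction at least [a / b], the
    second less than [a.+1 / b], and the set for [u] is contained in the other. *)
Lemma measure_converging_gap p k D a b N0 t u C n l : 0 < b ->
  (forall u, extends k (code_bits k.+1 D) t u ->
     b * mass p u N0 < a.+1 * 2 ^ cond_len u) ->
  extends k (code_bits k.+1 D) t u -> a * 2 ^ cond_len u <= b * mass p u n ->
  follows k D u C -> cond_len u <= l -> cond_bound u <= l -> N0 <= n ->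
  (mu (converging p (initial C l) N0 `\` converging p u n) <= (b%:R^-1)%:E)%E.
Proof.
move=> b0 hN0 tu au uC ul wl N0n.
have [mA eA] := measure_converging p (initial C l) N0.
have [mB eB] := measure_converging p u n.
have sub := converging_initial (p := p) uC ul wl N0n.
have fA : (mu (converging p (initial C l) N0) < +oo)%E.
  by rewrite ltey_eq fin_num_measure.
have eD : mu (converging p (initial C l) N0 `\` converging p u n) =
    (mu (converging p (initial C l) N0) - mu (converging p u n))%E.
  by rewrite measureD// (setIidr sub).
have tl : cond_len t <= l by apply: leq_trans ul; have /extendsP[] := tu.
have := hN0 _ (extends_initial (follows_extends tu uC) tl).
have lE : cond_len (initial C l) = l.
  by rewrite /cond_len /initial !(nfst_pair, nsnd_pair).
rewrite eD eA eB lE -EFinB lee_fin => lt.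
have b0' : (0 < b%:R :> R)%R by rewrite ltr0n.
have le1 : ((mass p (initial C l) N0)%:R / 2 ^+ l <= a.+1%:R / b%:R :> R)%R.
  rewrite ler_pdivrMr ?exprn_gt0// mulrAC ler_pdivlMr// -natrX -!natrM ler_nat.
  by rewrite mulnC ltnW.
have le2 : (a%:R / b%:R <= (mass p u n)%:R / 2 ^+ cond_len u :> R)%R.
  rewrite ler_pdivlMr ?exprn_gt0// mulrAC ler_pdivrMr// -natrX -!natrM ler_nat.
  by rewrite [leqRHS]mulnC.
apply: le_trans (lerB le1 le2) _.
by rewrite -mulrBl -natrB// subSnn mul1r.
Qed.

(** For fixed [X], a dominated [Y] either keeps [escape Y] below the search time on a whole window
    of arguments, which is rare, or first reaches it at some [n] whose condition missed [X], which
    averaging over [n] shows to be rare for most [X]. *)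
Lemma forcing_step p m j k D t0 : exists t1,
  extends k (code_bits k.+1 D) t0 t1 /\
  forall C, follows k D t1 C -> exists Bad : set cantor,
    [/\ measurable Bad, (mu Bad <= (2 ^- j)%:E)%E & forall X, ~ Bad X ->
      exists V : set cantor, [/\ measurable V, dominated p m (join X C) `<=` V
        & (mu V <= (2 ^- j + 2 ^- j)%:E)%E]].
Proof.
(* [b] is the square of [2 ^ j], so that Markov's inequality can turn a mean
   of at most [b^-1] into an exceptional set of measure at most [2 ^- j]. *)
pose b := 4 ^ j; have b0 : 0 < b by rewrite expn_gt0.
have [a [t [N0 [t0t dense crit]]]] :=
  exists_critical_mass (godel p) k (code_bits k.+1 D) t0 b.
pose e := << godel p, << t, << << k, code_bits k.+1 D >>, << a, b >> >> >> >>.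
have goodE N t' u : good e N t' u = extends k (code_bits k.+1 D) t' u &&
    (a * 2 ^ cond_len u <= b * mass (godel p) u N).
  by rewrite /good /e !(nfst_pair, nsnd_pair).
have rootE : idx_root e = t by rewrite /idx_root /e !(nfst_pair, nsnd_pair).
have gex : forall t' N, extends (nfst (nfst (nsnd (nsnd e))))
    (nsnd (nfst (nsnd (nsnd e)))) (idx_root e) t' -> exists u, good e N t' u.
  move=> t' N; rewrite rootE /e !(nfst_pair, nsnd_pair) => /(dense _ N)[u hu].
  by exists u; rewrite goodE.
have fe := found_total gex.
pose tau := found_cond e.
have tauP N : extends k (code_bits k.+1 D) t (tau N) /\ good e N (tau N) (tau N.+1).
  by have := found_condP gex N; rewrite rootE {1 2 3}/e !(nfst_pair, nsnd_pair).
have tau_mono N N' : N <= N' -> extends k (code_bits k.+1 D) (tau N) (tau N').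
  move=> /subnK <-; elim: (N' - N) => [|i IHi]; first exact: extends_refl.
  rewrite addSn; apply: extends_trans IHi _.
  by have [_] := tauP (i + N); rewrite goodE => /andP[].
pose M := maxn m N0.
(* The escaping [Y] for which [escape Y] never reaches the search time on the window from [M.+1] to
   [L]. By [escapeP] these sets shrink to the empty set as [L] grows. *)
pose Vdom L : set cantor := [set Y | escaping Y /\
  forall n, M < n <= L -> ~~ found e n (escape Y n)].
have mfound n : measurable [set Y : cantor | found e n (escape Y n)].
  apply: (@measurable_prefix n.+2) => Y Y' YY /=.
  by rewrite (escape_prefix YY).
have mVdom L : measurable (Vdom L).
  rewrite (_ : Vdom L = (escaping : set cantor) `&`
      \bigcap_(n in [set n | (M < n <= L)%N])
      ~` [set Y : cantor | found e n (escape Y n)]).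
    apply: measurableI; first exact: measurable_escaping.
    by apply: bigcap_measurableType => n _; exact: measurableC.
  apply/seteqP; split=> Y [tY hY]; split=> // n hn; first exact/negP/hY.
  exact/negP/hY.
have [L VL] : exists L, (mu (Vdom L) <= (2 ^- j)%:E)%E.
  apply: measure_bigcap_small => //.
    move=> L L' LL; apply/subsetPset => Y [tY hY]; split=> // n /andP[Mn nL].
    by apply: hY; rewrite Mn (leq_trans nL).
  apply/seteqP; split=> // Y hY.
  have [tY _] := hY 0%N I; have [n Mn fn] := escapeP M fe tY.
  by have [_ /(_ n)] := hY n I; rewrite Mn leqnn fn => /(_ isT).
(* Any [C] that follows [tau L.+1] follows every [tau n.+1] with [n <= L]. *)
exists (tau L.+1); split; first exact: (extends_trans t0t (tauP L.+1).1).
move=> C LC.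
have tauC n : n <= L -> follows k D (tau n.+1) C.
  by move=> nL; apply: follows_extends LC; exact: tau_mono.
(* The oracles that converge up to [N0] along [C] but were missed by the condition found for [n]. *)
pose W n l : set cantor := converging (godel p) (initial C l) N0 `\`
  converging (godel p) (tau n.+1) n.
have mW n l : measurable (W n l).
  by apply: measurableD; exact: (measure_converging (godel p) _ _).1.
pose late n := M < n <= L.
(* Convergence along [C] shows in all sufficiently long initial segments, hence the limit inferior
   over [l]. *)
pose E n : set cantor := if late n
  then \bigcup_i \bigcap_(l in [set l | (i <= l)%N]) W n l else set0.
have c0 : (0 <= (b%:R^-1 : R))%R by rewrite invr_ge0.
have hE n : measurable (E n) /\ (mu (E n) <= (b%:R^-1)%:E)%E.
  rewrite /E /late; case: ifP => [/andP[Mn nL]|_]; last by rewrite measure0 lee_fin.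
  apply: (measure_liminf_le (l0 := tau n.+1)) => // l tl.
  have [h1 h2] := cond_le (tau n.+1).
  apply: (measure_converging_gap b0 crit _ _ (tauC n nL)).
  - by have [] := tauP n.+1.
  - by have [_] := tauP n; rewrite goodE => /andP[].
  - exact: leq_trans tl.
  - exact: leq_trans tl.
  - by apply: leq_trans (ltnW Mn); exact: leq_maxr.
(* The [Y] for which [n] is the first argument past [M] where [escape Y] reaches the search time.
   These sets are disjoint, so their measures serve as weights. *)
pose Z n : set cantor := [set Y | M < n /\ found e n (escape Y n) /\
  forall i, M < i < n -> ~~ found e i (escape Y i)].
have mZ n : measurable (Z n).
  apply: (@measurable_prefix n.+2) => Y Y' YY [Mn [fn hn]].
  split=> //; split; first by rewrite -(escape_prefix YY).
  move=> i Min; rewrite -(@escape_prefix Y Y'); first exact: hn.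
  by move=> i' i'i; apply: YY; move: Min i'i; lia.
have tZ : trivIset setT Z.
  apply/trivIsetP => n n' _ _; rewrite neq_ltn => /orP[nn|nn];
    apply/seteqP; split=> // Y [[Mn [fn hn]] [Mn' [fn' hn']]].
    by have := hn' n; rewrite Mn nn fn => /(_ isT).
  by have := hn n'; rewrite Mn' nn fn' => /(_ isT).
pose beta n := fine (mu (Z n)).
have betaE n : (beta n)%:E = mu (Z n) by rewrite fineK// fin_num_measure.
have beta0 n : (0 <= beta n)%R by rewrite fine_ge0.
have beta1 : (\sum_(n < L.+1) beta n <= 1)%R.
  rewrite -lee_fin -sumEFin.
  rewrite (eq_bigr (fun i : 'I_L.+1 => mu (Z i))) => [|i _]; last exact: betaE.
  rewrite -measure_bigsetU//; apply: probability_le1.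
  exact: bigsetU_measurable.
have j0 : (0 < 2 ^- j :> R)%R by rewrite invr_gt0 exprn_gt0.
have [Bad [mBad hBad BadP]] := weighted_markov (fun n => (hE n).1) beta0 beta1
  (fun n => (hE n).2) j0.
exists Bad; split=> //.
  apply: le_trans hBad _; rewrite lee_fin invrK /b natrX -[4%N]/(2 * 2)%N natrM.
  by rewrite exprMn invfM -mulrA mulVf ?mulr1// expf_neq0.
move=> X /BadP le.
(* For [n <= L], a [Y] in [Z n] can be dominated only if [X] lies in [E n]; the measures of the
   [U n] add up to the weighted sum at [X]. *)
pose U n : set cantor := if `[< E n X >] then Z n else set0.
have mU n : measurable (U n) by rewrite /U; case: ifP.
have mUU : measurable (\big[setU/set0]_(n < L.+1) U n).
  exact: bigsetU_measurable.
exists (Vdom L `|` \big[setU/set0]_(n < L.+1) U n); split.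
- exact: measurableU.
- move=> Y [tY [f [fr fdom]]]; have [VY|VY] := pselect (Vdom L Y); first by left.
  right; have [n0 n0P] : exists n, (M < n <= L) && found e n (escape Y n).
    apply: contrapT => h; apply: VY; split=> // n nP; apply/negP => fn.
    by apply: h; exists n; rewrite nP.
  have exn : exists n, (M < n <= L) && found e n (escape Y n) by exists n0.
  case: (ex_minnP exn) => n /andP[/andP[Mn nL] fn] nmin.
  rewrite -bigcup_mkord; exists n; first by rewrite /= ltnS.
  have ZY : Z n Y.
    split=> //; split=> // i /andP[Mi i_n]; apply/negP => fi.
    have := nmin i; rewrite Mi fi (ltnW (leq_trans i_n nL)) => /(_ isT).
    by rewrite leqNgt i_n.
  rewrite /U ifT//; apply/asboolP; rewrite /E /late Mn nL /=.
  (* Otherwise the value at [n] would be below [tau n.+1], which is at most [escape Y n], against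
     domination. *)
  have nconv : ~ converging (godel p) (tau n.+1) n X.
    have [h1 h2] := cond_le (tau n.+1).
    move=> /(converging_initial (tauC n nL) h1 h2 (leqnn n)).
    rewrite /converging /initial /cond_len /cond_bits /cond_bound /=.
    rewrite !(nfst_pair, nsnd_pair) => /converges_sound/(_ n (leqnn n))[y ylt yr].
    have := fdom n (leq_ltn_trans (leq_maxl _ _) Mn).
    rewrite (run_functional (fr n) yr).
    rewrite ltnNge => /negP[]; apply: ltnW.
    exact: leq_trans ylt (found_cond_le gex fn).
  have [|i iP] := @converges_complete X C p N0; first by move=> n' _; exists (f n').
  exists i => // l /= il; split=> //.
  rewrite /converging /initial /cond_len /cond_bits /cond_bound /=.
  by rewrite !(nfst_pair, nsnd_pair); exact: iP.
apply: (@le_trans _ _ (mu (Vdom L) + mu (\big[setU/set0]_(n < L.+1) U n))%E).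
  exact: measureU2.
rewrite EFinD; apply: leeD => //.
apply: le_trans (Boole_inequality mu (fun n _ => mU n)) _.
rewrite (eq_bigr (fun n : 'I_L.+1 => (beta n * \1_(E n) X)%:E)) ?sumEFin ?lee_fin//.
move=> n _; rewrite /U indicE; case: asboolP => h.
  by rewrite mem_set// mulr1 betaE.
by rewrite memNset// mulr0 measure0.
Qed.

(** * Construction of the generic set *)

Definition nth_program (c : nat) : program := sval (cid (godel_surj c)).

Lemma nth_godel p : nth_program (godel p) = p.
Proof. by rewrite /nth_program; case: cid => q /= /godel_inj. Qed.

Lemma extends_weaken k k' D t u : k <= k' ->
  extends k' (code_bits k'.+1 D) t u -> extends k (code_bits k.+1 D) t u.
Proof.
move=> kk /extendsP[tu h]; apply/extendsP; split=> // z /h.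
case: ifP => // _ hz zk; have zk' := leq_trans zk kk.
by rewrite hz// !bit_locks.
Qed.

Lemma extends_long k d t l : exists2 u, extends k d t u & l <= cond_len u.
Proof.
pose l' := maxn l (cond_len t).
pose c := code_bits l' (fun z =>
  if z < cond_len t then bit (cond_bits t) z else bit d (nfst z)).
pose u := << c, << l', 0 >> >>.
have lu : cond_len u = l' by rewrite /cond_len !(nfst_pair, nsnd_pair).
have cu : cond_bits u = c by rewrite /cond_bits nfst_pair.
exists u; last by rewrite lu leq_maxl.
apply/extendsP; rewrite lu cu leq_maxr; split=> // z zl.
by rewrite bit_code zl; case: (z < cond_len t).
Qed.

Definition rarely_dominated (i : nat) (p : program) (m : nat)
    (C : nat -> bool) : Prop :=
  exists Bad : set cantor,
    [/\ measurable Bad, (mu Bad <= (2 ^- i)%:E)%E & forall X, ~ Bad X ->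
      exists V : set cantor, [/\ measurable V, dominated p m (join X C) `<=` V
        & (mu V <= (2 ^- i + 2 ^- i)%:E)%E]].

(** Stage [k] locks the columns up to [k] to [D] and treats the triple coded by [k] as
    [<<godel p, <<m, i>>>>]; [C] is the limit of the conditions. *)
Lemma exists_generic (D : nat -> bool) : exists C : nat -> bool,
  (forall n, exists s, forall t, s <= t -> C <<n, t>> = D n) /\
  forall p m i, rarely_dominated i p m C.
Proof.
have /boolp.choice[F hF] : forall kt : nat * nat, exists u,
    [/\ extends kt.1 (code_bits kt.1.+1 D) kt.2 u, kt.1 < cond_len u &
      forall C, follows kt.1 D u C -> rarely_dominated (nsnd (nsnd kt.1))
        (nth_program (nfst kt.1)) (nfst (nsnd kt.1)) C].
  move=> [k t] /=.
  have [t1 [tt1 ht1]] := forcing_step (nth_program (nfst k))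
    (nfst (nsnd k)) (nsnd (nsnd k)) k D t.
  have [u t1u lu] := extends_long k (code_bits k.+1 D) t1 k.+1.
  exists u; split=> //; first exact: extends_trans t1u.
  by move=> C /(follows_extends t1u)/ht1.
pose T := fix T k := if k is k'.+1 then F (k', T k') else << 0, << 0, 0 >> >>.
have TE k : T k.+1 = F (k, T k) by [].
have Text k k' : k <= k' -> extends k (code_bits k.+1 D) (T k.+1) (T k'.+1).
  move=> /subnK <-; elim: (k' - k) => [|i IHi]; first exact: extends_refl.
  rewrite addSn; apply: extends_trans IHi _.
  apply: (@extends_weaken _ (i + k).+1); first by lia.
  by rewrite [T (i + k).+2]TE; have [] := hF ((i + k).+1, T (i + k).+1).
have Tlen k : k < cond_len (T k.+1) by rewrite TE; have [] := hF (k, T k).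
have agree k k' z : k <= k' -> z < cond_len (T k.+1) ->
    bit (cond_bits (T k'.+1)) z = bit (cond_bits (T k.+1)) z.
  move=> /Text/extendsP[le h] zk; have := h z; rewrite zk; apply.
  exact: leq_trans le.
(* Position [z] is already decided by [T z.+1], whose length exceeds [z]. *)
pose C z := bit (cond_bits (T z.+1)) z.
have CE z k : z <= k -> C z = bit (cond_bits (T k.+1)) z.
  by move=> zk; rewrite (agree z).
have Cfollows k : follows k D (T k.+1) C.
  split=> z.
    by move=> zk; rewrite (CE _ (maxn z k)) ?leq_maxl// (agree k)// leq_maxr.
  move=> kz zk; rewrite (CE _ (maxn z k)) ?leq_maxl//.
  have /extendsP[_ h] := Text k (maxn z k) (leq_maxr _ _).
  have := h z; rewrite [z < cond_len (T k.+1)]ltnNge kz /= bit_locks//; apply=> //.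
  exact: leq_ltn_trans (leq_maxl _ _) (Tlen _).
exists C; split=> [n|p m i].
  exists (cond_len (T n.+1)) => t nt; have [_ h] := Cfollows n.
  rewrite h ?nfst_pair//; have := leq_npair n t; lia.
pose k := << godel p, << m, i >> >>.
have [_ _ /(_ C (Cfollows k))] := hF (k, T k).
by rewrite /= /k !(nfst_pair, nsnd_pair) nth_godel.
Qed.

(** * Passage to almost all oracles *)

(** As in the Borel-Cantelli lemma, the [X] lying in [Bad i] for all large [i] form a null set; any
    other [X] avoids [Bad i] for arbitrarily large [i], so its dominated set has arbitrarily small
    covers. *)
Lemma negligible_dominated C p m : (forall i, rarely_dominated i p m C) ->
  mu.-negligible [set X : cantor | ~ mu.-negligible (dominated p m (join X C))].
Proof.
move=> /boolp.choice[Bad hBad].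
apply: (@negligibleS _ _ _ _
    (\bigcup_i0 \bigcap_(i in [set i | (i0 <= i)%N]) Bad i)).
  move=> X nX; apply: contrapT => h; apply: nX.
  apply: negligible_half_powers => i.
  (* The bound at [i'] is twice [2 ^- i'], hence the choice of [i'] above [i]. *)
  have [i' [ii' nB]] : exists i', i < i' /\ ~ Bad i' X.
    apply: contrapT => h'; apply: h; exists i.+1 => // i' /= ii'.
    by apply: contrapT => nB; apply: h'; exists i'.
  have [_ _ /(_ X nB)[V [mV sV lV]]] := hBad i'.
  exists V; split=> //; apply: le_trans lV _; rewrite lee_fin.
  have -> : (2 ^- i = 2 ^- i.+1 + 2 ^- i.+1 :> R)%R.
    rewrite -mulr2n -[RHS]mulr_natl exprS invfM mulrA mulfV ?mul1r//.
  by apply: lerD; rewrite lef_pV2 ?posrE ?exprn_gt0// ler_weXn2l// ler1n.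
apply: negligible_bigcup => i0; apply: negligible_half_powers => i.
have [mB lB _] := hBad (maxn i i0).
exists (Bad (maxn i i0)); split=> //.
  by move=> X; apply; rewrite /= leq_maxr.
apply: le_trans lB _; rewrite lee_fin.
by rewrite lef_pV2 ?posrE ?exprn_gt0// ler_weXn2l ?leq_maxl// ler1n.
Qed.

(** The complement is covered by one cylinder of measure [2 ^- e.+2] for each [e], and these
    measures sum to at most 1/2. *)
Lemma escaping_not_negligible : ~ mu.-negligible (escaping : set cantor).
Proof.
move=> [K [mK K0 sK]].
pose cyl e : set cantor := cylinder (mkseq (bit (stuck e)) e.+2).
have mcyl e : measurable (cyl e) by exact: measurable_cylinder.
have mU : measurable (\bigcup_e cyl e) by exact: bigcupT_measurable.
have cover : [set: cantor] `<=` K `|` \bigcup_e cyl e.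
  move=> Y _; have [tY|nY] := pselect (escaping Y); first by left; exact: sK.
  by right; have [e he] := not_escaping_cylinder nY; exists e.
have half : (mu (\bigcup_e cyl e) <= (2^-1)%:E)%E.
  have := @measure_sigma_subadditive _ _ _ mu (\bigcup_e cyl e) cyl mcyl mU
    (@subset_refl _ _).
  move=> /le_trans; apply.
  apply: lime_le; first exact: is_cvg_nneseries.
  apply: nearW => n; rewrite (eq_bigr (fun e => (2 ^- e.+2)%:E)); last first.
    by move=> e _; have := mu_cylinder (mkseq (bit (stuck e)) e.+2); rewrite size_mkseq.
  rewrite sumEFin lee_fin.
  suff -> : (\sum_(0 <= e < n) 2 ^- e.+2 = 2^-1 - 2 ^- n.+1 :> R)%R.
    by rewrite lerBlDr lerDl invr_ge0 exprn_ge0.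
  elim: n => [|n IHn]; first by rewrite big_geq// expr1 subrr.
  rewrite big_nat_recr//= IHn -addrA; congr (_ + _)%R.
  rewrite [(2 ^+ n.+2)%R]exprS invfM; set x := (_^-1)%R.
  by rewrite -[(- x)%R]mul1r; field.
have : (mu [set: cantor] <= (2^-1)%:E)%E.
  apply: (@le_trans _ _ (mu (K `|` \bigcup_e cyl e))).
    by apply: le_measure => //; rewrite inE//; exact: measurableU.
  have le : (mu (K `|` \bigcup_e cyl e) <= mu K + mu (\bigcup_e cyl e))%E.
    exact: measureU2.
  by apply: le_trans le _; rewrite K0 add0e.
by rewrite probability_setT lee_fin leNgt invf_lt1// ltr1n.
Qed.

Lemma almost_all_below_high : {ae mu, forall X : cantor,
  exists B : nat -> bool, [/\ turing_le X B, high B &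
    ~ {ae mu, forall Y : cantor, forall g, computable_from Y g ->
        exists2 f, computable_from B f & dominates f g}]}.
Proof.
(* Shifted by one, because column 0 of [join X C] is taken by [X]. *)
pose D n := if n is n'.+1 then jump (jump empty) n' else false.
have [C [limC rareC]] := exists_generic D.
pose N c : set cantor := [set X | ~ mu.-negligible
  (dominated (nth_program (nfst c)) (nsnd c) (join X C))].
apply: (@negligibleS _ _ _ _ (\bigcup_c N c)); last first.
  by apply: negligible_bigcup => c; apply: negligible_dominated.
move=> X nX; apply: contrapT => nN; apply: nX.
have negl p m : mu.-negligible (dominated p m (join X C)).
  apply: contrapT => h; apply: nN; exists << godel p, m >> => //.
  by rewrite /N /= nfst_pair nsnd_pair nth_godel.
exists (join X C); split.
- apply: (@computable_ext _ (fun i => join X C << 0, i >>)) => [i|].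
    by rewrite /join nfst_pair nsnd_pair.
  apply/computable_oracle/computable_pair; last exact: computable_id.
  exact: computable_const.
- apply: limit_le_jump => n; have [s hs] := limC n.+1.
  by exists s => t /hs h; rewrite /join nfst_pair.
(* If [join X C] were almost everywhere dominating, almost every escaping [Y] would have [escape Y]
   dominated through one of countably many pairs of [p] and [m], each giving a null set. *)
move=> dom; apply: escaping_not_negligible.
apply: (@negligibleS _ _ _ _ (~` [set Y : cantor | forall g, computable_from Y g ->
    exists2 f, computable_from (join X C) f & dominates f g] `|`
    \bigcup_c dominated (nth_program (nfst c)) (nsnd c) (join X C))).
  move=> Y tY; have [h|h] := pselect (forall g, computable_from Y g ->
    exists2 f, computable_from (join X C) f & dominates f g); last by left.
  right; have [f [p pf] [m mf]] := h _ (computable_escape tY).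
  exists << godel p, m >> => //; rewrite nfst_pair nsnd_pair nth_godel.
  by split=> //; exists f.
apply: negligibleU; first exact: dom.
by apply: negligible_bigcup => c.
Qed.

End FairCoin.

Theorem corollary3p4 (R : realType) :
  {ae fair_coin R, forall X : cantor,
    exists B : nat -> bool,
      [/\ turing_le X B, high B & ~ ae_dominating R B]}.
Proof. exact: almost_all_below_high (@fair_coin_cylinder R). Qed.
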